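(* There exists a $4$-dimensional linear subspace $L_{quadr}\subset T$ and constants $0<c_d\le c_u<+\infty$ such that for every $l\in L_{quadr}$ one has $$-c_u\|l\|^2t^2\le D(C_{\mathfrak m}+tl)-D(C_{\mathfrak m})\le -c_d\|l\|^2t^2$$ for all sufficiently small $t>0$ (depending on $l$), while for every $l\in T\setminus L_{quadr}$ there are constants $0<c_d'(l)\le c_u'(l)<+\infty$ such that $$-c_u'(l)\,t\le D(C_{\mathfrak m}+tl)-D(C_{\mathfrak m})\le -c_d'(l)\,t$$ for all sufficiently small $t>0$ (depending on $l$).
   Context: Let $\mathbb S^2\subset\mathbb R^3$ be the unit sphere centered at the origin and let $M$ be the 3-dimensional manifold of (unoriented) lines tangent to $\mathbb S^2$; a point of $M$ is a pair $(x,\xi)$, $x\in\mathbb S^2$, $\xi$ a unit tangent vector to $\mathbb S^2$ at $x$, with $(x,\xi)$ and $(x,-\xi)$ identified. $M^6$ is the manifold of 6-tuples $\mathbf m=(u_1,\dots,u_6)$ with $u_i\in M$. For $u,v\in M$ let $d_{uv}$ be the Euclidean distance between the lines $u$ and $v$, and let $D(\mathbf m)=\min_{1\le i<j\le 6} d_{u_iu_j}$. Coordinates: a point of $\mathbb S^2$ is written $(\varphi,\varkappa)$ with latitude $\varphi\in[-\pi/2,\pi/2]$ and longitude $\varkappa$ (modulo $2\pi$), i.e. it is the point $(\cos\varphi\cos\varkappa,\cos\varphi\sin\varkappa,\sin\varphi)$. For $x\in\mathbb S^2$ different from the poles, $[x,\uparrow_\delta]$ denotes the tangent line at $x$ whose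 direction is obtained from the unit tangent vector at $x$ pointing North (along the meridian) by the rotation by the angle $\delta$ about the axis from the origin to $x$, counterclockwise when viewed from the tip of $x$. For angles $\varphi,\delta,\varkappa$ let $C_6(\varphi,\delta,\varkappa)=(A,B,C,D,E,F)$ be the configuration of six tangent lines $$A=[(\varphi,\tfrac{\pi}{6}-\varkappa),\uparrow_\delta],\quad B=[(\varphi,\tfrac{5\pi}{6}-\varkappa),\uparrow_\delta],\quad C=[(\varphi,\tfrac{3\pi}{2}-\varkappa),\uparrow_\delta],$$ $$D=[(-\varphi,\tfrac{\pi}{2}+\varkappa),\uparrow_\delta],\quad E=[(-\varphi,\tfrac{7\pi}{6}+\varkappa),\uparrow_\delta],\quad F=[(-\varphi,\tfrac{11\pi}{6}+\varkappa),\uparrow_\delta].$$ Then $C_{\mathfrak m}=C_6(\varphi_{\mathfrak m},\delta_{\mathfrak m},\varkappa_{\mathfrak m})$ with $\varphi_{\mathfrak m}=\arcsin\sqrt{3/11}$, $\delta_{\mathfrak m}=\arctan\sqrt{5/11}$, $\varkappa_{\mathfrak m}=-\arctan(1/\sqrt{15})$. To work modulo the diagonal action of $SO(3)$, the line $A$ is kept fixed: $T$ denotes the 15-dimensional tangent space at $C_{\mathfrak m}$ of the submanifold of $M^6$ consisting of the 6-tuples whose first line is the line $A$ of $C_{\mathfrak m}$. Fix any smooth Riemannian metric on this 15-dimensional submanifold; $\|\cdot\|$ is the corresponding norm on $T$, and $C_{\mathfrak m}+tl$ stands for the exponential map at $C_{\mathfrak m}$ applied to the tangent vector $tl$, $l\in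 T$.
   Formalization: The rotation by δ defining ↑_δ is taken from North towards East (clockwise viewed from the tip of x) instead of counterclockwise; with the literal orientation d(A,D)² ≈ 0.0208 and D can increase linearly, so the claim would fail. *)

(* Defs.v *)
From HB Require Import structures.
From mathcomp Require Import all_boot all_order all_algebra.
From mathcomp Require Import all_classical all_reals all_analysis.

Set Implicit Arguments.
Unset Strict Implicit.
Unset Printing Implicit Defensive.

Import Order.TTheory GRing.Theory Num.Theory.
Import numFieldNormedType.Exports.

Local Open Scope classical_set_scope.
Local Open Scope ring_scope.

Section Riemannian.
Context {R : realType} {n : nat}.
Implicit Types (U : set 'rV[R]_n) (g : 'rV[R]_n -> 'M[R]_n).

Definition partial (i : 'I_n) (f : 'rV[R]_n -> R) : 'rV[R]_n -> R :=
  fun q => 'D_(delta_mx 0 i) f q.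

(* C^oo on U: the iterated partial derivatives of every order exist on U and
   are continuous there. *)
Definition smooth_on U (f : 'rV[R]_n -> R) : Prop :=
  forall s : seq 'I_n, forall q, U q ->
    {for q, continuous (foldr partial f s)} /\
    forall i : 'I_n, derivable (foldr partial f s) q (delta_mx 0 i).

(* The Gram matrix of a Riemannian metric in local coordinates ranging over U. *)
Definition riemannian_metric U g : Prop :=
  [/\ forall i j : 'I_n, smooth_on U (fun q => g q i j),
      forall q, U q -> (g q)^T = g q &
      forall q, U q -> forall v : 'rV[R]_n, v != 0 ->
        0 < (v *m g q *m v^T) 0 0].

Definition riemannian_norm g (p v : 'rV[R]_n) : R :=
  Num.sqrt ((v *m g p *m v^T) 0 0).

(* Christoffel symbol of the second kind, Gamma^k_ij. *)
Definition christoffel g (k i j : 'I_n) (q : 'rV[R]_n) : R :=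
  2^-1 * \sum_l invmx (g q) k l *
    (partial i (fun x => g x j l) q + partial j (fun x => g x i l) q
     - partial l (fun x => g x i j) q).

Definition geodesic_at U g (gamma : R -> 'rV[R]_n) (t : R) : Prop :=
  [/\ U (gamma t), derivable gamma t 1, derivable (derive1 gamma) t 1 &
      forall k : 'I_n, derive1 (derive1 gamma) t 0 k =
        - \sum_i \sum_j christoffel g k i j (gamma t)
                        * derive1 gamma t 0 i * derive1 gamma t 0 j].

(* For every tangent vector v at p, t |-> expm (t v) is, near t = 0, the
   geodesic issuing from p with velocity v. This determines t |-> expm (t v)
   for small t; no condition is put on expm far from 0. *)
Definition exponential_map U g (p : 'rV[R]_n) (expm : 'rV[R]_n -> 'rV[R]_n)
    : Prop :=
  forall v : 'rV[R]_n, let gamma := fun t : R => expm (t *: v) in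
    [/\ gamma 0 = p, derive1 gamma 0 = v & \forall t \near 0, geodesic_at U g gamma t].

End Riemannian.

Section TangentLines.
Context {R : realType}.

Definition vec3 (a b c : R) : 'rV[R]_3 := \row_k nth 0 [:: a; b; c] k.

(* The norm of the matrix library is the sup norm. *)
Definition euclidean_norm (v : 'rV[R]_3) : R := Num.sqrt (\sum_k v 0 k ^+ 2).

Definition sphere_point (phi kappa : R) : 'rV[R]_3 :=
  vec3 (cos phi * cos kappa) (cos phi * sin kappa) (sin phi).

Definition north (phi kappa : R) : 'rV[R]_3 :=
  vec3 (- (sin phi * cos kappa)) (- (sin phi * sin kappa)) (cos phi).

Definition east (kappa : R) : 'rV[R]_3 := vec3 (- sin kappa) (cos kappa) 0.

(* The line [(phi, kappa), up_delta] as a set of points. A positive delta turns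
   the direction from North towards East, i.e. clockwise for an observer outside
   the sphere. This is the orientation for which the angles phi_m, delta_m and
   kappa_m below give min_dist C_m = sqrt (12 / 11). With the opposite one the
   first and fourth lines of C_m would be at distance less than 1/5, and C_m
   would not be a critical configuration. *)
Definition tangent_line (phi kappa delta : R) : set 'rV[R]_3 :=
  [set sphere_point phi kappa
       + s *: (cos delta *: north phi kappa + sin delta *: east kappa)
  | s in [set: R]].

Definition line_dist (u v : set 'rV[R]_3) : R :=
  inf [set euclidean_norm (x - y) | x in u & y in v].

(* The initial value of the minimum is itself one of the distances. *)
Definition min_dist (m : 'I_6 -> set 'rV[R]_3) : R :=
  \big[Num.min/line_dist (m 0) (m 1)]_(p : 'I_6 * 'I_6 | (p.1 < p.2)%N)
    line_dist (m p.1) (m p.2).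

(* Row i lists the latitude, the longitude and the direction of the i-th line. *)
Definition lines (a : 'M[R]_(6, 3)) : 'I_6 -> set 'rV[R]_3 :=
  fun i => tangent_line (a i 0) (a i 1) (a i 2).

Definition C6_angles (phi delta kappa : R) : 'M[R]_(6, 3) :=
  \matrix_(i, k) nth 0 (nth [::]
    [:: [:: phi; pi / 6 - kappa; delta];
        [:: phi; 5 * pi / 6 - kappa; delta];
        [:: phi; 3 * pi / 2 - kappa; delta];
        [:: - phi; pi / 2 + kappa; delta];
        [:: - phi; 7 * pi / 6 + kappa; delta];
        [:: - phi; 11 * pi / 6 + kappa; delta]] i) k.

Definition C6 (phi delta kappa : R) : 'I_6 -> set 'rV[R]_3 :=
  lines (C6_angles phi delta kappa).

Definition phi_m : R := asin (Num.sqrt (3 / 11)).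
Definition delta_m : R := atan (Num.sqrt (5 / 11)).
Definition kappa_m : R := - atan (1 / Num.sqrt 15).

Definition C_m : 'I_6 -> set 'rV[R]_3 := C6 phi_m delta_m kappa_m.

(* Local coordinates on the submanifold of 6-tuples with first line A: the
   15 angles of the last five lines, at points other than the poles. *)
Definition chart_domain : set 'rV[R]_15 :=
  [set q | forall i : 'I_5, - (pi / 2) < q 0 (inord (3 * i)) < pi / 2].

Definition chart (q : 'rV[R]_15) : 'I_6 -> set 'rV[R]_3 :=
  lines (\matrix_(i, k) if i == 0 then C6_angles phi_m delta_m kappa_m 0 k
                        else q 0 (inord (3 * i.-1 + k))).

Definition chart_C_m : 'rV[R]_15 :=
  \row_j C6_angles phi_m delta_m kappa_m (inord (j %/ 3).+1) (inord (j %% 3)).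

Lemma chart_chart_C_m : chart chart_C_m = C_m.
Proof.
rewrite /C_m /C6 /chart; congr lines; apply/matrixP => i k.
rewrite mxE /chart_C_m; case: (eqVneq i 0) => [->//|i0].
have i_gt0 : (0 < i)%N by rewrite lt0n.
have k3 : (k < 3)%N := ltn_ord k.
have lt15 : (3 * i.-1 + k < 15)%N.
  apply: (@leq_trans (3 * i.-1 + 3)%N); first by rewrite ltn_add2l.
  by rewrite -mulnSr prednK // (leq_mul2l 3 i 5) -ltnS ltn_ord.
rewrite mxE (inordK lt15) mulnC divnMDl // modnMDl divn_small // modn_small //.
by rewrite addn0 prednK // !inord_val.
Qed.

End TangentLines.
Arguments C_m : clear implicits.
Arguments chart_C_m : clear implicits.
Arguments chart_domain : clear implicits.

(* Main.v *)
Require Import Defs.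
From HB Require Import structures.
From mathcomp Require Import all_boot all_order all_algebra.
From mathcomp Require Import all_classical all_reals all_analysis.
From mathcomp Require Import ring lra.

Set Implicit Arguments.
Unset Strict Implicit.
Unset Printing Implicit Defensive.

Import Order.TTheory GRing.Theory Num.Theory.
Import numFieldNormedType.Exports.

Local Open Scope classical_set_scope.
Local Open Scope ring_scope.

(* A line tangent to the sphere at x with unit direction u has Pluecker
   coordinates (u, x × u), and the distance of two such lines is |N| / sqrt (1 - S^2)
   with S = u . v and N = (x × u) . v + u . (y × v). At C_m twelve of the fifteen
   distances equal sqrt (12 / 11) and the other three are larger, so near C_m only
   the signs of the twelve functions P = 11 N^2 - 12 (1 - S^2) matter. Expand P
   along a geodesic to second order. The twelve derivatives have rank 11 and satisfy
   one linear relation, whose coefficients (the stress 1, 6 + 2 sqrt 5,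
   6 - 2 sqrt 5) are positive. Hence outside the 4-dimensional common kernel some
   derivative is negative, and D decreases linearly. On the kernel the
   stress-weighted sum of the second derivatives is independent of the metric; it
   is a negative definite quadratic form in four variables, so one of the distances
   decreases at least quadratically, and none decreases faster. *)

(** * Second order expansions *)

(** The threshold on [t] may depend on [l], but the constants [c_d] and [c_u] may not. Every
    quantity is therefore expanded on the right of 0 with a remainder treated for each [l]
    separately, while the coefficients are bounded uniformly by powers of [|l|].

    The metric enters only through the second order motion of the frames (x, u, x × u).
    Orthonormality fixes all but three of the second order terms of u and x × u for each line, and
    these three enter the expansion of P through the same linear form as the velocity. The stress
    thus cancels them exactly as it cancels the first derivatives.

    On the kernel no single second derivative has a known sign, but a negative weighted sum forces
    one of the twelve below the average, which suffices for a minimum. The sup norm is used up to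
    the end and is compared with the Riemannian norm at the base point only in the final
    constants. *)

Section Jets.
Context {R : realType}.
Implicit Types (f g : R -> R) (a b c : R).

Let cvg0 : (t : R) @[t --> 0^'+] --> (0 : R).
Proof. by apply: cvg_at_right_filter; exact: cvg_id. Qed.

Let cvg0_sqr : t * t @[t --> (0 : R)^'+] --> (0 * 0 : R).
Proof. exact: (cvgM cvg0 cvg0). Qed.

Let cvg_quad a b c : a + b * t + c * (t * t) @[t --> 0^'+] --> a + b * 0 + c * (0 * 0).
Proof.
exact: (cvgD (cvgD (cvg_cst _) (cvgM (cvg_cst _) cvg0)) (cvgM (cvg_cst _) cvg0_sqr)).
Qed.

Let cvg_lim_eq f a b : f t @[t --> 0^'+] --> a -> a = b -> f t @[t --> 0^'+] --> b.
Proof. by move=> + <-. Qed.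

(** The coefficient [c] is half of the second derivative, so products have no binomial factors. *)
Definition jet f a b c : Prop :=
  exists2 e : R -> R, e t @[t --> 0^'+] --> 0 &
    \forall t \near 0^'+, f t = a + b * t + c * t ^+ 2 + e t * t ^+ 2.

Lemma jet_cst k : jet (fun=> k) k 0 0.
Proof.
exists (fun=> 0); first exact: cvg_cst.
by near=> t; rewrite !mul0r !addr0.
Unshelve. all: by end_near. Qed.

Lemma jetD f a b c g a' b' c' : jet f a b c -> jet g a' b' c' ->
  jet (fun t => f t + g t) (a + a') (b + b') (c + c').
Proof.
move=> [e e0 fE] [h h0 gE]; exists (fun t => e t + h t).
  by rewrite -[X in _ --> X]addr0; exact: cvgD.
near=> t; rewrite (near fE t)// (near gE t)//; ring.
Unshelve. all: by end_near. Qed.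

Lemma jetN f a b c : jet f a b c -> jet (fun t => - f t) (- a) (- b) (- c).
Proof.
move=> [e e0 fE]; exists (fun t => - e t).
  by rewrite -[X in _ --> X]oppr0; exact: cvgN.
near=> t; rewrite (near fE t)//; ring.
Unshelve. all: by end_near. Qed.

Lemma jetM f a b c g a' b' c' : jet f a b c -> jet g a' b' c' ->
  jet (fun t => f t * g t) (a * a') (a * b' + b * a')
      (a * c' + b * b' + c * a').
Proof.
move=> [e e0 fE] [h h0 gE].
exists (fun t => e t * (a' + b' * t + c' * (t * t)) +
  h t * (a + b * t + c * (t * t)) + e t * h t * (t * t) +
  (b * c' + c * b') * t + c * c' * (t * t)).
  have q1 := @cvg_quad a' b' c'; have q2 := @cvg_quad a b c.
  apply: cvg_lim_eq (cvgD (cvgD (cvgD (cvgD (cvgM e0 q1) (cvgM h0 q2))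
    (cvgM (cvgM e0 h0) cvg0_sqr)) (cvgM (cvg_cst _) cvg0))
    (cvgM (cvg_cst _) cvg0_sqr)) _.
  ring.
near=> t; rewrite (near fE t)// (near gE t)//; ring.
Unshelve. all: by end_near. Qed.

(** Divide by [t] and let [t] tend to 0, twice. This uniqueness is what allows an identity such as
    |u|^2 = 1 to be differentiated along the motion. *)
Lemma jet_eq0 a b c : jet (fun=> 0) a b c -> [/\ a = 0, b = 0 & c = 0].
Proof.
move=> [e e0 eE].
have lim0 (h : R -> R) l : h t @[t --> 0^'+] --> l ->
    (\forall t \near 0^'+, h t = 0) -> l = 0.
  move=> hl h0; apply: (@cvg_unique _ _ (h t @[t --> 0^'+])) => //.
  apply: (@cvg_trans _ ((fun=> (0 : R)) @ (0 : R)^'+)); last exact: cvg_cst.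
  by apply: near_eq_cvg; near=> t; rewrite (near h0 t).
have a0 : a = 0.
  apply: (lim0 (fun t => a + b * t + c * (t * t) + e t * (t * t))).
    apply: cvg_lim_eq (cvgD (@cvg_quad _ _ _) (cvgM e0 cvg0_sqr)) _.
    ring.
  by near=> t; rewrite -expr2 -(near eE t).
have b0 : b = 0.
  apply: (lim0 (fun t => b + c * t + e t * t)).
    apply: cvg_lim_eq
      (cvgD (cvgD (cvg_cst _) (cvgM (cvg_cst _) cvg0)) (cvgM e0 cvg0)) _.
    ring.
  near=> t.
  have tn0 : t != 0 by apply: lt0r_neq0; near: t; exact: nbhs_right_gt.
  apply: (mulIf tn0); rewrite mul0r.
  have /esym E : 0 = a + b * t + c * t ^+ 2 + e t * t ^+ 2 by near: t.
  by rewrite -[RHS]E a0; ring.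
split=> //; apply: (lim0 (fun t => c + e t)).
  by rewrite -[X in _ --> X]addr0; exact: (cvgD (cvg_cst _) e0).
near=> t.
have tn0 : t != 0 by apply: lt0r_neq0; near: t; exact: nbhs_right_gt.
apply: (mulIf (expf_neq0 2 tn0)); rewrite mul0r.
have /esym E : 0 = a + b * t + c * t ^+ 2 + e t * t ^+ 2 by near: t.
by rewrite -[RHS]E a0 b0; ring.
Unshelve. all: by end_near. Qed.

Lemma jet_cst_eq k f a b c : (forall t, f t = k) -> jet f a b c ->
  [/\ a = k, b = 0 & c = 0].
Proof.
move=> fk fj; have := jetD fj (jetN (jet_cst k)).
have -> : (fun t => f t + - k) = fun=> 0 by apply/funext => t; rewrite fk subrr.
by move=> /jet_eq0[/subr0_eq -> ]; rewrite !oppr0 !addr0.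
Qed.

Lemma is_derive_quad a b c (x : R) :
  is_derive x (1 : R) (fun t => a + b * t + c * t ^+ 2) (b + 2 * c * x).
Proof. by apply: is_derive_eq; rewrite /GRing.scale /=; ring. Qed.

(** Taylor's formula in Peano form. The mean value theorem for the remainder [g] gives g t / t^2 =
    ((f' c - f' 0) / c - d) (c / t) with 0 < c < t, and the first factor is small by
    differentiability of [f'] at 0 alone. *)
Lemma jet_taylor (f f' : R -> R) (d : R) :
  (\forall t \near (0 : R), is_derive t (1 : R) f (f' t)) ->
  is_derive (0 : R) (1 : R) f' d ->
  jet f (f 0) (f' 0) (d / 2).
Proof.
move=> df [df' f'd].
pose g t := f t - (f 0 + f' 0 * t + d / 2 * t ^+ 2).
exists (fun t => g t / t ^+ 2); last first.
  near=> t.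
  have tn0 : t != 0 by apply: lt0r_neq0; near: t; exact: nbhs_right_gt.
  by rewrite /g divfK ?expf_neq0//; ring.
apply/cvgr0Pnorm_le => eps eps0.
have : \forall h \near 0^', `|h^-1 * (f' h - f' 0) - d| <= eps.
  have /cvgrPdist_le/(_ _ eps0) := df'.
  rewrite -/(derive f' 0 1) f'd; apply: filterS => h.
  by rewrite distrC /= [_%:A]mulr1 addr0.
rewrite near_withinE => /nbhs_ballP[e1 /= e10 he].
have /nbhs_ballP[e2 /= e20 hd] := df.
near=> t.
have t0 : 0 < t by near: t; exact: nbhs_right_gt.
have te1 : t < e1 by near: t; exact: nbhs_right_lt.
have te2 : t < e2 by near: t; exact: nbhs_right_lt.
have dg x : x \in `[0, t] -> is_derive x (1 : R) g (f' x - (f' 0 + d * x)).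
  rewrite in_itv/= => /andP[x0 xt].
  have dfx : is_derive x (1 : R) f (f' x).
    by apply: hd; rewrite /ball/= sub0r normrN ger0_norm// (le_lt_trans xt).
  have := is_deriveB dfx (is_derive_quad (f 0) (f' 0) (d / 2) x).
  by rewrite (_ : 2 * (d / 2) * x = d * x)//; field.
have cg : {within `[0, t], continuous g}.
  by apply: derivable_within_continuous => x xt; have [] := dg x xt.
have dg' x : x \in `]0, t[ -> is_derive x (1 : R) g (f' x - (f' 0 + d * x)).
  by move=> xt; apply: dg; exact: subset_itv_oo_cc xt.
have [c] := MVT t0 dg' cg.
rewrite in_itv/= => /andP[c0 ct].
have g0 : g 0 = 0 by rewrite /g; ring.
rewrite g0 !subr0 => ->.
have : `|c^-1 * (f' c - f' 0) - d| <= eps.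
  apply: (he c); last by rewrite gt_eqF.
  by rewrite /ball/= sub0r normrN gtr0_norm// (lt_trans ct).
have -> : f' c - (f' 0 + d * c) = c * (c^-1 * (f' c - f' 0) - d).
  by field; rewrite gt_eqF.
move=> hc.
have -> : c * (c^-1 * (f' c - f' 0) - d) * t / t ^+ 2 =
          (c^-1 * (f' c - f' 0) - d) * (c / t).
  by field; rewrite !gt_eqF.
rewrite normrM (gtr0_norm (divr_gt0 c0 t0)).
rewrite -[leRHS]mulr1 ler_pM//; first by rewrite divr_ge0// ltW.
by rewrite ler_pdivrMr// mul1r ltW.
Unshelve. all: by end_near. Qed.

(** The strict gap between [c] and [k] absorbs the remainder. It is the source of the halved
    constants and of the added ones in the final estimates. *)
Lemma jet_le f b c k : jet f 0 b c -> c < k -> b <= 0 ->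
  \forall t \near 0^'+, f t <= k * t ^+ 2.
Proof.
move=> [e e0 fE] ck b0.
have kc : 0 < k - c by rewrite subr_gt0.
have /cvgr0Pnorm_le/(_ _ kc) ek := e0.
near=> t.
rewrite (near fE t)// add0r.
have t0 : 0 < t by near: t; exact: nbhs_right_gt.
have : e t <= k - c by apply: le_trans (ler_norm _) _; near: t; exact: ek.
move=> etk; have := ler_wpM2r (sqr_ge0 t) etk.
have := mulr_ge0_le0 (ltW t0) b0.
lra.
Unshelve. all: by end_near. Qed.

Lemma jet_lt f b c k : jet f 0 b c -> b < k ->
  \forall t \near 0^'+, f t <= k * t.
Proof.
move=> [e e0 fE] bk.
have : c * t + e t * t @[t --> 0^'+] --> c * 0 + 0 * 0.
  exact: (cvgD (cvgM (cvg_cst _) cvg0) (cvgM e0 cvg0)).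
rewrite !mulr0 addr0.
have kc : 0 < k - b by rewrite subr_gt0.
move=> /cvgr0Pnorm_le/(_ _ kc) ek.
near=> t.
rewrite (near fE t)// add0r.
have t0 : 0 < t by near: t; exact: nbhs_right_gt.
have : c * t + e t * t <= k - b.
  by apply: le_trans (ler_norm _) _; near: t; exact: ek.
move=> etk; have := ler_wpM2r (ltW t0) etk.
lra.
Unshelve. all: by end_near. Qed.

Lemma jet_gt0 f a b c : jet f a b c -> 0 < a ->
  \forall t \near 0^'+, a / 2 <= f t.
Proof.
move=> [e e0 fE] a0.
have : b * t + c * (t * t) + e t * (t * t) @[t --> 0^'+] -->
    b * 0 + c * (0 * 0) + 0 * (0 * 0).
  exact: (cvgD (cvgD (cvgM (cvg_cst _) cvg0) (cvgM (cvg_cst _) cvg0_sqr))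
    (cvgM e0 cvg0_sqr)).
rewrite !mulr0 !addr0.
have a20 : 0 < a / 2 by rewrite divr_gt0.
move=> /cvgr0Pnorm_le/(_ _ a20) ek.
near=> t.
rewrite (near fE t)//.
have : `|b * t + c * (t * t) + e t * (t * t)| <= a / 2 by near: t; exact: ek.
by rewrite ler_norml => /andP[+ _]; lra.
Unshelve. all: by end_near. Qed.

End Jets.

(** * Expansions depending on a direction, with uniformly bounded coefficients *)

Section JetFamilies.
Context {R : realType} {V : normedModType R}.
Implicit Types (F G : V -> R -> R) (b c : V -> R).

Definition dominated (d : nat) b : Prop :=
  exists C, forall l, `|b l| <= C * `|l| ^+ d.

Lemma dominated0 d : dominated d (fun=> 0).
Proof. by exists 0 => l; rewrite normr0 mul0r. Qed.

Lemma dominatedD d b c : dominated d b -> dominated d c ->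
  dominated d (fun l => b l + c l).
Proof.
move=> [B hB] [C hC]; exists (B + C) => l.
by rewrite mulrDl (le_trans (ler_normD _ _))// lerD.
Qed.

Lemma dominatedM d d' b c : dominated d b -> dominated d' c ->
  dominated (d + d') (fun l => b l * c l).
Proof.
move=> [B hB] [C hC]; exists (B * C) => l.
by rewrite exprD mulrACA normrM ler_pM.
Qed.

Lemma dominatedZ k d b : dominated d b -> dominated d (fun l => k * b l).
Proof.
move=> [B hB]; exists (`|k| * B) => l.
by rewrite normrM -mulrA ler_wpM2l.
Qed.

Lemma dominatedN d b : dominated d b -> dominated d (fun l => - b l).
Proof. by move=> [B hB]; exists B => l; rewrite normrN. Qed.

Lemma dominated_sum d (I : Type) (r : seq I) (b : I -> V -> R) :
  (forall i, dominated d (b i)) -> dominated d (fun l => \sum_(i <- r) b i l).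
Proof.
move=> hb; elim: r => [|i r IHr].
  by under [X in dominated _ X]eq_fun do rewrite big_nil; exact: dominated0.
under [X in dominated _ X]eq_fun do rewrite big_cons.
exact: dominatedD.
Qed.

Definition jets F (a : R) b c : Prop :=
  [/\ forall l, jet (F l) a (b l) (c l), dominated 1 b & dominated 2 c].

Lemma jets_cst k : jets (fun _ _ => k) k (fun=> 0) (fun=> 0).
Proof. by split=> [l||]; [exact: jet_cst|exact: dominated0..]. Qed.

Lemma jetsD F a b c G a' b' c' : jets F a b c -> jets G a' b' c' ->
  jets (fun l t => F l t + G l t) (a + a')
       (fun l => b l + b' l) (fun l => c l + c' l).
Proof.
move=> [Fj b1 c2] [Gj b'1 c'2].
by split=> [l||]; [exact: jetD|exact: dominatedD..].
Qed.

Lemma jetsN F a b c : jets F a b c ->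
  jets (fun l t => - F l t) (- a) (fun l => - b l) (fun l => - c l).
Proof.
by move=> [Fj b1 c2]; split=> [l||]; [exact: jetN|exact: dominatedN..].
Qed.

Lemma jetsM F a b c G a' b' c' : jets F a b c -> jets G a' b' c' ->
  jets (fun l t => F l t * G l t) (a * a')
       (fun l => a * b' l + b l * a') (fun l => a * c' l + b l * b' l + c l * a').
Proof.
move=> [Fj b1 c2] [Gj b'1 c'2]; split=> [l||]; first exact: jetM.
- apply: dominatedD; first exact: dominatedZ.
  under [X in dominated _ X]eq_fun do rewrite mulrC; exact: dominatedZ.
- apply: dominatedD; first apply: dominatedD; first exact: dominatedZ.
    exact: (@dominatedM 1 1).
  under [X in dominated _ X]eq_fun do rewrite mulrC; exact: dominatedZ.
Qed.

End JetFamilies.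

(** * Expansion of functions of one coordinate along a geodesic *)

Section ExponentialJets.
Context {R : realType} {n : nat}.

Lemma entry_le_norm (l : 'rV[R]_n) (k : 'I_n) : `|l 0 k| <= `|l|.
Proof.
rewrite [leRHS]mx_normrE.
exact: (@le_bigmax _ _ _ 0 (fun i : 'I_1 * 'I_n => `|l i.1 i.2|) (0, k)).
Qed.

Lemma dominated_entry (k : 'I_n) : dominated 1 (fun l : 'rV[R]_n => l 0 k).
Proof. by exists 1 => l; rewrite mul1r expr1 entry_le_norm. Qed.

(* The second derivative at 0 of the k-th coordinate of the geodesic issuing
   from p with velocity l. *)
Definition geodesic_acc (g : 'rV[R]_n -> 'M[R]_n) p (k : 'I_n) (l : 'rV[R]_n) :=
  - \sum_i \sum_j christoffel g k i j p * l 0 i * l 0 j.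

Lemma dominated_geodesic_acc g p k : dominated 2 (geodesic_acc g p k).
Proof.
apply: dominatedN; apply: dominated_sum => i; apply: dominated_sum => j.
apply: (@dominatedM _ _ 1 1); last exact: dominated_entry.
by apply: dominatedZ; exact: dominated_entry.
Qed.

Lemma is_derive_coord (gamma : R -> 'rV[R]_n) (k : 'I_n) (t : R) :
  derivable gamma t 1 ->
  is_derive t (1 : R) (fun x => gamma x 0 k) (derive1 gamma t 0 k).
Proof.
move=> dg; have /derivable_mxP/(_ 0 k) dgk := dg.
by split=> //; rewrite derive1E (derive_mx dg) mxE.
Qed.

(** The geodesic equation makes the second derivative at 0 a quadratic form in [l], with Christoffel
    symbols taken at the fixed point [p]; hence the uniform bound. The functions of interest are the
    cosine and sine of an angle. *)
Lemma exponential_jets (U : set 'rV[R]_n) g p expm (f f' f'' : R -> R)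
    (k : 'I_n) :
  exponential_map U g p expm ->
  (forall x : R, is_derive x (1 : R) f (f' x)) ->
  (forall x : R, is_derive x (1 : R) f' (f'' x)) ->
  exists2 c : 'rV[R]_n -> R, dominated 2 c &
    jets (fun (l : 'rV[R]_n) t => f (expm (t *: l) 0 k)) (f (p 0 k))
         (fun l : 'rV[R]_n => f' (p 0 k) * l 0 k) c.
Proof.
move=> expP df df'.
exists (fun l : 'rV[R]_n => (f'' (p 0 k) * (l 0 k * l 0 k) +
                  f' (p 0 k) * geodesic_acc g p k l) / 2).
  under [X in dominated _ X]eq_fun do rewrite mulrC.
  apply: dominatedZ; apply: dominatedD; apply: dominatedZ.
    by apply: (@dominatedM _ _ 1 1); exact: dominated_entry.
  exact: dominated_geodesic_acc.
split=> [l||]; last 2 first.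
- by apply: dominatedZ; exact: dominated_entry.
- under [X in dominated _ X]eq_fun do rewrite mulrC.
  apply: dominatedZ; apply: dominatedD; apply: dominatedZ.
    by apply: (@dominatedM _ _ 1 1); exact: dominated_entry.
  exact: dominated_geodesic_acc.
have [/= g0 dg0 geo] := expP l.
set gamma := fun t : R => expm (t *: l) in g0 dg0 geo *.
have geo0 := nbhs_singleton geo.
have <- : gamma 0 = p by [].
have dl : derive1 gamma 0 0 k = l 0 k by rewrite dg0.
rewrite -{1}dl.
have := @jet_taylor R (fun t => f (gamma t 0 k))
  (fun t => f' (gamma t 0 k) * derive1 gamma t 0 k).
apply.
- near=> t.
  have [_ dgt _ _] : geodesic_at U g gamma t by near: t.
  have dgk := is_derive_coord k dgt.
  have := @is_derive1_comp _ f (fun x => gamma x 0 k) t _ _ (df _) dgk.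
  by rewrite /comp.
- have [_ dgt ddgt /(_ k) acc] := geo0.
  have dgk := is_derive_coord k dgt.
  have ddgk := is_derive_coord k ddgt.
  have dfk := @is_derive1_comp _ f' (fun x => gamma x 0 k) 0 _ _ (df' _) dgk.
  have := is_deriveM dfk ddgk.
  move=> dP; apply: is_derive_eq; rewrite acc dl /geodesic_acc -/gamma dg0 /GRing.scale /=.
  ring.
Unshelve. all: by end_near. Qed.

End ExponentialJets.

(** * Distance of two lines *)

Section LineDistance.
Context {R : realType}.
Implicit Types (u v w x y z : 'rV[R]_3).

Definition dotv u v : R := \sum_k u 0 k * v 0 k.

Definition crossv u v : 'rV[R]_3 :=
  vec3 (u 0 1 * v 0 2 - u 0 2 * v 0 1) (u 0 2 * v 0 0 - u 0 0 * v 0 2)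
       (u 0 0 * v 0 1 - u 0 1 * v 0 0).

Lemma sum3E (F : 'I_3 -> R) : \sum_k F k = F 0 + F 1 + F 2.
Proof.
rewrite !big_ord_recl big_ord0 addr0 addrA.
by congr (F _ + F _ + F _); exact: val_inj.
Qed.

Lemma dotvE u v : dotv u v = u 0 0 * v 0 0 + u 0 1 * v 0 1 + u 0 2 * v 0 2.
Proof. exact: sum3E. Qed.

Lemma vec3E (a b c : R) :
  (vec3 a b c 0 0 = a) * (vec3 a b c 0 1 = b) * (vec3 a b c 0 2 = c).
Proof. by rewrite !mxE. Qed.

Lemma dotvC u v : dotv u v = dotv v u.
Proof. by apply: eq_bigr => k _; rewrite mulrC. Qed.

Lemma dotvDl u v w : dotv (u + v) w = dotv u w + dotv v w.
Proof. by rewrite !dotvE !mxE; ring. Qed.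

Lemma dotvZl k u w : dotv (k *: u) w = k * dotv u w.
Proof. by rewrite !dotvE !mxE; ring. Qed.

Lemma dotvDr u v w : dotv w (u + v) = dotv w u + dotv w v.
Proof. by rewrite !(dotvC w) dotvDl. Qed.

Lemma dotvZr k u w : dotv w (k *: u) = k * dotv w u.
Proof. by rewrite !(dotvC w) dotvZl. Qed.

Lemma dotv_ge0 u : 0 <= dotv u u.
Proof. by apply: sumr_ge0 => k _; rewrite -expr2 sqr_ge0. Qed.

Lemma sqr_dotv_le u v : dotv u v ^+ 2 <= dotv u u * dotv v v.
Proof.
rewrite -subr_ge0 (_ : _ - _ = dotv (crossv u v) (crossv u v)) ?dotv_ge0//.
by rewrite !dotvE !vec3E; ring.
Qed.

Definition line x u : set 'rV[R]_3 := [set x + s *: u | s in [set: R]].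

(** With n = u × v, Lagrange's identity gives |n|^2 = 1 - (u . v)^2. All connecting vectors have the
    same product with n, so Cauchy-Schwarz bounds their length from below, and the common
    perpendicular attains the bound. *)
Lemma line_distE x y u v : dotv u u = 1 -> dotv v v = 1 -> dotv u v ^+ 2 < 1 ->
  line_dist (line x u) (line y v) =
  Num.sqrt (dotv (x - y) (crossv u v) ^+ 2 / (1 - dotv u v ^+ 2)).
Proof.
move=> u1 v1 uv1.
set n := crossv u v; set G := 1 - dotv u v ^+ 2.
have G0 : 0 < G by rewrite subr_gt0.
have nG : dotv n n = G.
  rewrite /G -[1]mulr1 -{1}u1 -v1 /n !dotvE !vec3E; ring.
have sub_norm s t : euclidean_norm (x + s *: u - (y + t *: v)) =
    Num.sqrt (dotv (x - y + s *: u - t *: v) (x - y + s *: u - t *: v)).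
  congr Num.sqrt; apply: eq_bigr => k _; rewrite !mxE; ring.
have dotn s t : dotv (x - y + s *: u - t *: v) n = dotv (x - y) n.
  by rewrite /n !dotvE !vec3E !mxE; ring.
rewrite /line_dist; set E := [set _ | _ in _ & _ in _].
have lbE : lbound E (Num.sqrt (dotv (x - y) n ^+ 2 / G)).
  move=> _ [_ [s _ <-] [_ [t _ <-] <-]].
  rewrite sub_norm ler_wsqrtr// ler_pdivrMr// -nG -(dotn s t).
  exact: sqr_dotv_le.
have inE : E (Num.sqrt (dotv (x - y) n ^+ 2 / G)).
  (* The feet of the common perpendicular: [s] and [t] solve the two linear equations w . u = w . v
     = 0. *)
  pose s := (dotv u v * dotv (x - y) v - dotv (x - y) u) / G.
  pose t := (dotv (x - y) v - dotv u v * dotv (x - y) u) / G.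
  exists (x + s *: u); first by exists s.
  exists (y + t *: v); first by exists t.
  rewrite sub_norm; congr Num.sqrt.
  set w := x - y + s *: u - t *: v.
  apply: (mulIf (lt0r_neq0 G0)); rewrite divfK ?lt0r_neq0//.
  have wE z : dotv w z = dotv (x - y) z + s * dotv u z - t * dotv v z.
    by rewrite /w !dotvE !mxE; ring.
  have wu : dotv w u = 0.
    by rewrite wE u1 (dotvC v u) /s /t /G; field; rewrite -/G lt0r_neq0.
  have wv : dotv w v = 0.
    by rewrite wE v1 /s /t /G; field; rewrite -/G lt0r_neq0.
  have wn k : crossv w n 0 k = u 0 k * dotv w v - v 0 k * dotv w u.
    rewrite /n [in RHS]dotvE [in RHS]dotvE.
    have : k \in [:: 0; 1; 2] by case: k => [[|[|[|]]] //].
    by rewrite !inE => /or3P[]/eqP->; rewrite !vec3E; ring.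
  rewrite -nG -(dotn s t) -/w.
  (* Lagrange's identity for w and n. The cross product vanishes by the triple product formula [wn],
     since w is orthogonal to u and v. *)
  transitivity (dotv w n ^+ 2 + dotv (crossv w n) (crossv w n)).
    by rewrite !dotvE !vec3E; ring.
  by rewrite [dotv (crossv w n) _]dotvE !wn wu wv; ring.
apply/eqP; rewrite eq_le; apply/andP; split.
  by apply: ge_inf => //; exists (Num.sqrt (dotv (x - y) n ^+ 2 / G)).
by apply: lb_le_inf => //; exists (Num.sqrt (dotv (x - y) n ^+ 2 / G)).
Qed.

(* The line through x with unit direction u orthogonal to x has Pluecker
   coordinates (u, x × u); the numerator of the distance is their pairing. *)
Lemma pluecker_pairing x y u v :
  dotv (x - y) (crossv u v) = dotv (crossv x u) v + dotv u (crossv y v).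
Proof. by rewrite !dotvE !vec3E !mxE; ring. Qed.

Lemma min_dist_le (m : 'I_6 -> set 'rV[R]_3) (i j : 'I_6) :
  (i < j)%N -> min_dist m <= line_dist (m i) (m j).
Proof.
by move=> ij; rewrite /min_dist (@bigmin_le_cond _ _ _ _ (i, j)).
Qed.

Lemma le_min_dist (m : 'I_6 -> set 'rV[R]_3) c :
  (forall i j : 'I_6, (i < j)%N -> c <= line_dist (m i) (m j)) ->
  c <= min_dist m.
Proof. by move=> cm; apply/bigmin_geP; split=> [|[i j]]; exact: cm. Qed.

Local Notation D0 := (Num.sqrt (12 / 11 : R)).

(** Since 1 - S^2 <= 1, the quotient is at most 12 / 11 - c / 11. By concavity the square root lies
    below its tangent at 12 / 11, of slope 1 / (2 D0); hence the factor 22. *)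
Lemma sqrt_le_sub (S N c : R) : S ^+ 2 < 1 -> 0 <= c ->
  11 * N ^+ 2 - 12 * (1 - S ^+ 2) <= - c ->
  Num.sqrt (N ^+ 2 / (1 - S ^+ 2)) - D0 <= - (c / (22 * D0)).
Proof.
move=> S1 c0 Pc.
have G0 : 0 < 1 - S ^+ 2 by rewrite subr_gt0.
have D00 : 0 < D0 by rewrite sqrtr_gt0 divr_gt0.
have D2 : D0 ^+ 2 = 12 / 11 by rewrite sqr_sqrtr// divr_ge0.
set q := N ^+ 2 / (1 - S ^+ 2).
have q0 : 0 <= q by rewrite divr_ge0 ?sqr_ge0// ltW.
have q2 : Num.sqrt q ^+ 2 = q by rewrite sqr_sqrtr.
have qle : q <= 12 / 11 - c / 11.
  rewrite ler_pdivrMr//.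
  have : c * (1 - S ^+ 2) <= c.
    by rewrite -[leRHS]mulr1 ler_wpM2l// lerBlDr lerDl sqr_ge0.
  lra.
have s0 : 0 <= Num.sqrt q := sqrtr_ge0 _.
rewrite -opprB lerN2 -(ler_pM2r D00).
have -> : c / (22 * D0) * D0 = c / 22 by field; exact: lt0r_neq0.
have := sqr_ge0 (D0 - Num.sqrt q).
lra.
Qed.

(** Here dividing by 1 - S^2 may enlarge the deficit, so a lower bound [g0] is required. A deficit e
    of the quotient costs the square root at most e / D0, because D0^2 - q = (D0 - sqrt q) (D0 +
    sqrt q). *)
Lemma sub_le_sqrt (S N c g0 : R) : 0 < g0 -> g0 <= 1 - S ^+ 2 -> 0 <= c ->
  - c <= 11 * N ^+ 2 - 12 * (1 - S ^+ 2) ->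
  - (c / (11 * g0 * D0)) <= Num.sqrt (N ^+ 2 / (1 - S ^+ 2)) - D0.
Proof.
move=> g00 gS c0 Pc.
have G0 : 0 < 1 - S ^+ 2 by exact: lt_le_trans gS.
have D00 : 0 < D0 by rewrite sqrtr_gt0 divr_gt0.
have D2 : D0 ^+ 2 = 12 / 11 by rewrite sqr_sqrtr// divr_ge0.
set q := N ^+ 2 / (1 - S ^+ 2).
have q0 : 0 <= q by rewrite divr_ge0 ?sqr_ge0// ltW.
have q2 : Num.sqrt q ^+ 2 = q by rewrite sqr_sqrtr.
have qge : 12 / 11 - c / (11 * g0) <= q.
  rewrite ler_pdivlMr//.
  have : c <= c / g0 * (1 - S ^+ 2).
    by rewrite mulrAC ler_pdivlMr// ler_wpM2l.
  have -> : c / (11 * g0) = c / g0 / 11 by field; exact: lt0r_neq0.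
  lra.
have s0 : 0 <= Num.sqrt q := sqrtr_ge0 _.
have e0 : 0 <= c / (11 * g0) by rewrite divr_ge0// mulr_ge0// ltW.
rewrite lerNl opprB -(ler_pM2r D00).
have -> : c / (11 * g0 * D0) * D0 = c / (11 * g0).
  by field; rewrite !lt0r_neq0.
have [sD|/ltW sD] := leP (Num.sqrt q) D0.
  have := mulr_ge0 s0 (_ : 0 <= D0 - Num.sqrt q).
  rewrite subr_ge0 => /(_ sD).
  lra.
have := mulr_ge0 (ltW D00) (_ : 0 <= Num.sqrt q - D0).
rewrite subr_ge0 => /(_ sD).
lra.
Qed.

End LineDistance.

(** * Moving frames *)

Section MovingFrame.
Context {R : realType} {V : normedModType R}.
Implicit Types (X Y : V -> R -> 'rV[R]_3).

Definition vjets X (x : 'rV[R]_3) (x1 x2 : V -> 'rV[R]_3) : Prop :=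
  forall k : 'I_3, jets (fun l t => X l t 0 k) (x 0 k)
                        (fun l => x1 l 0 k) (fun l => x2 l 0 k).

Lemma jets_ext (F G : V -> R -> R) a b c a' b' c' : jets F a b c ->
  (forall l t, F l t = G l t) -> a = a' -> b =1 b' -> c =1 c' ->
  jets G a' b' c'.
Proof.
move=> Fj FG <- /funext <- /funext <-.
by rewrite (_ : G = F)//; apply/funext => l; apply/funext => t.
Qed.

Lemma dotv_jets X Y x x1 x2 y y1 y2 : vjets X x x1 x2 -> vjets Y y y1 y2 ->
  jets (fun l t => dotv (X l t) (Y l t)) (dotv x y)
       (fun l => dotv x (y1 l) + dotv (x1 l) y)
       (fun l => dotv x (y2 l) + dotv (x1 l) (y1 l) + dotv (x2 l) y).
Proof.
move=> Xj Yj.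
have := jetsD (jetsD (jetsM (Xj 0) (Yj 0)) (jetsM (Xj 1) (Yj 1)))
  (jetsM (Xj 2) (Yj 2)).
by move=> /jets_ext; apply=> [l t||l|l]; rewrite !dotvE//; ring.
Qed.

Definition direction (p k d : R) : 'rV[R]_3 :=
  cos d *: north p k + sin d *: east k.

Lemma directionE (p k d : R) : direction p k d =
  vec3 (cos d * - (sin p * cos k) + sin d * - sin k)
       (cos d * - (sin p * sin k) + sin d * cos k) (cos d * cos p).
Proof.
apply/rowP => j; rewrite !mxE.
by case: j => [[|[|[|]]] ?] //=; rewrite ?mulr0 ?addr0.
Qed.

Definition conormal (p k d : R) : 'rV[R]_3 :=
  vec3 (sin d * - (sin p * cos k) - cos d * - sin k)
       (sin d * - (sin p * sin k) - cos d * cos k) (sin d * cos p).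

Lemma crossv_direction (p k d : R) :
  crossv (sphere_point p k) (direction p k d) = conormal p k d.
Proof.
have p1 := sin2cos2 p; have k1 := sin2cos2 k.
rewrite /crossv directionE /sphere_point /conormal !vec3E.
congr vec3; [ring: p1 k1..].
Qed.

Lemma lincomb3E (a b c : R) (u v w : 'rV[R]_3) k :
  (a *: u + b *: v + c *: w) 0 k = a * u 0 k + b * v 0 k + c * w 0 k.
Proof. by rewrite !mxE. Qed.

Section Frame.
Variables p k d : R.
Local Notation x := (sphere_point p k).
Local Notation u := (direction p k d).
Local Notation z := (conormal p k d).

Let p1 := sin2cos2 p.
Let k1 := sin2cos2 k.
Let d1 := sin2cos2 d.

Lemma frame_orthonormal :
  [/\ dotv x x = 1, dotv u u = 1 & dotv z z = 1] /\
  [/\ dotv x u = 0, dotv x z = 0 & dotv u z = 0].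
Proof.
rewrite directionE /sphere_point /conormal.
by split; split; rewrite dotvE !vec3E; ring: p1 k1 d1.
Qed.

Lemma frame_expand v : v = dotv v x *: x + dotv v u *: u + dotv v z *: z.
Proof.
rewrite directionE /sphere_point /conormal.
apply/rowP => j.
have : j \in [:: 0; 1; 2] by case: j => [[|[|[|]]] //].
by rewrite !inE => /or3P[]/eqP->;
  rewrite lincomb3E !dotvE !vec3E; ring: p1 k1 d1.
Qed.

End Frame.
End MovingFrame.

(** * Second order motion of the frame of a tangent line *)

Section LineJets.
Context {R : realType} {V : normedModType R}.
Implicit Types (P : V -> R -> R) (lp : V -> R).

(** The quadratic coefficients stay unspecified: they carry the Christoffel symbols and reach the
    final sum only through terms that the stress cancels. *)
Definition angle_jets P (p : R) lp : Prop :=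
  (exists c, jets (fun l t => cos (P l t)) (cos p) (fun l => - sin p * lp l) c) /\
  (exists c, jets (fun l t => sin (P l t)) (sin p) (fun l => cos p * lp l) c).

Lemma vjets_vec3 (X : V -> R -> 'rV[R]_3) (x : 'rV[R]_3) (x1 : V -> 'rV[R]_3)
    (f0 f1 f2 : V -> R -> R) :
  (forall l t, X l t = vec3 (f0 l t) (f1 l t) (f2 l t)) ->
  (exists c, jets f0 (x 0 0) (fun l => x1 l 0 0) c) ->
  (exists c, jets f1 (x 0 1) (fun l => x1 l 0 1) c) ->
  (exists c, jets f2 (x 0 2) (fun l => x1 l 0 2) c) ->
  exists x2, vjets X x x1 x2.
Proof.
move=> XE [c0 j0] [c1 j1] [c2 j2].
exists (fun l => vec3 (c0 l) (c1 l) (c2 l)) => k.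
have : k \in [:: 0; 1; 2] by case: k => [[|[|[|]]] //].
by rewrite !inE => /or3P[]/eqP->; [move: j0|move: j1|move: j2] => /jets_ext;
  apply=> // [l t|l]; rewrite ?XE ?vec3E.
Qed.

Lemma scale_vec3 (s a b c : R) : s *: vec3 a b c = vec3 (s * a) (s * b) (s * c).
Proof.
by apply/rowP => j; rewrite !mxE; case: j => [[|[|[|]]] ?].
Qed.

Lemma jets_dotv_cst (X Y : V -> R -> 'rV[R]_3) (x y : 'rV[R]_3)
    (x1 x2 y1 y2 : V -> 'rV[R]_3) k :
  vjets X x x1 x2 -> vjets Y y y1 y2 -> (forall l t, dotv (X l t) (Y l t) = k) ->
  forall l, dotv x (y2 l) + dotv (x1 l) (y1 l) + dotv (x2 l) y = 0.
Proof.
move=> Xj Yj XYk l; have [/(_ l) j _ _] := dotv_jets Xj Yj.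
by have [_ _ ->] := jet_cst_eq (XYk l) j.
Qed.

(* The signs of the directions can be chosen at will, since the lines are
   unoriented. The velocity of a line is recorded by its components a, b, c in
   the orthonormal frame (x, u, z); the unit length and orthogonality of u and
   z leave only three second order unknowns. *)
Lemma line_jets P p lp K k lk D d ld (s : R) : s ^+ 2 = 1 ->
  angle_jets P p lp -> angle_jets K k lk -> angle_jets D d ld ->
  let x := sphere_point p k in
  let u := s *: direction p k d in
  let z := s *: conormal p k d in
  let a l := s * (lp l * cos d + lk l * (cos p * sin d)) in
  let b l := s * (lp l * sin d - lk l * (cos p * cos d)) in
  let c l := lk l * sin p - ld l in
  exists e f h : V -> R,
    vjets (fun l t => s *: direction (P l t) (K l t) (D l t)) u
      (fun l => (- a l) *: x + 0 *: u + c l *: z)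
      (fun l => e l *: x + (- ((a l ^+ 2 + c l ^+ 2) / 2)) *: u + h l *: z) /\
    vjets (fun l t => s *: conormal (P l t) (K l t) (D l t)) z
      (fun l => (- b l) *: x + (- c l) *: u + 0 *: z)
      (fun l => f l *: x + (- h l - a l * b l) *: u +
                (- ((b l ^+ 2 + c l ^+ 2) / 2)) *: z).
Proof.
move=> s1 [[? cP] [? sP]] [[? cK] [? sK]] [[? cD] [? sD]] x u z a b c.
have p1 := sin2cos2 p; have k1 := sin2cos2 k; have d1 := sin2cos2 d.
have sj := @jets_cst R V s.
have [u2 Uj] : exists u2, vjets
    (fun l t => s *: direction (P l t) (K l t) (D l t)) u
    (fun l => (- a l) *: x + 0 *: u + c l *: z) u2.
  apply: (vjets_vec3 (fun l t => etrans
    (congr1 (fun v => s *: v) (directionE _ _ _)) (scale_vec3 _ _ _ _))).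
  - eexists; apply: jets_ext (jetsM sj (jetsD (jetsM cD (jetsN (jetsM sP cK)))
      (jetsM sD (jetsN sK)))) _ _ _ _ => // [|l].
      by rewrite /u directionE scale_vec3 vec3E.
    rewrite lincomb3E /x /u /z /a /c directionE !scale_vec3 !vec3E.
    by ring: p1 k1 d1 s1.
  - eexists; apply: jets_ext (jetsM sj (jetsD (jetsM cD (jetsN (jetsM sP sK)))
      (jetsM sD cK))) _ _ _ _ => // [|l].
      by rewrite /u directionE scale_vec3 vec3E.
    rewrite lincomb3E /x /u /z /a /c directionE !scale_vec3 !vec3E.
    by ring: p1 k1 d1 s1.
  - eexists; apply: jets_ext (jetsM sj (jetsM cD cP)) _ _ _ _ => // [|l].
      by rewrite /u directionE scale_vec3 vec3E.
    rewrite lincomb3E /x /u /z /a /c directionE !scale_vec3 !vec3E.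
    by ring: p1 k1 d1 s1.
have [z2 Zj] : exists z2, vjets
    (fun l t => s *: conormal (P l t) (K l t) (D l t)) z
    (fun l => (- b l) *: x + (- c l) *: u + 0 *: z) z2.
  apply: (vjets_vec3 (fun l t => scale_vec3 _ _ _ _)).
  - eexists; apply: jets_ext (jetsM sj (jetsD (jetsM sD (jetsN (jetsM sP cK)))
      (jetsN (jetsM cD (jetsN sK))))) _ _ _ _ => // [|l].
      by rewrite /z scale_vec3 vec3E.
    rewrite lincomb3E /x /u /z /b /c directionE !scale_vec3 !vec3E.
    by ring: p1 k1 d1 s1.
  - eexists; apply: jets_ext (jetsM sj (jetsD (jetsM sD (jetsN (jetsM sP sK)))
      (jetsN (jetsM cD cK)))) _ _ _ _ => // [|l].
      by rewrite /z scale_vec3 vec3E.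
    rewrite lincomb3E /x /u /z /b /c directionE !scale_vec3 !vec3E.
    by ring: p1 k1 d1 s1.
  - eexists; apply: jets_ext (jetsM sj (jetsM sD cP)) _ _ _ _ => // [|l].
      by rewrite /z scale_vec3 vec3E.
    rewrite lincomb3E /x /u /z /b /c directionE !scale_vec3 !vec3E.
    by ring: p1 k1 d1 s1.
have [[xx uu zz] [xu xz uz]] : [/\ dotv x x = 1, dotv u u = 1 & dotv z z = 1] /\
    [/\ dotv x u = 0, dotv x z = 0 & dotv u z = 0].
  have [[xx uu zz] [xu xz uz]] := frame_orthonormal p k d.
  rewrite /u /z !dotvZl !dotvZr uu zz xu xz uz !mulr1 !mulr0 -expr2 s1.
  by split; split.
have expand v : v = dotv v x *: x + dotv v u *: u + dotv v z *: z.
  rewrite {1}(frame_expand p k d v) /u /z !dotvZr !scalerA.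
  by rewrite ![s * _ * s]mulrAC -!expr2 s1 !mul1r.
have ortho l t := frame_orthonormal (P l t) (K l t) (D l t).
(* Differentiating |u|^2 = 1, |z|^2 = 1 and u . z = 0 twice fixes the u-component of [u2] and the
   z-component of [z2], and ties the u-component of [z2] to the z-component of [u2]. *)
have UU : forall l, dotv u (u2 l) + dotv ((- a l) *: x + 0 *: u + c l *: z)
    ((- a l) *: x + 0 *: u + c l *: z) + dotv (u2 l) u = 0.
  apply: (jets_dotv_cst Uj Uj (k := 1)) => l t; have [[_ e1 _] _] := ortho l t.
  by rewrite dotvZl dotvZr e1 mulr1 -expr2.
have ZZ : forall l, dotv z (z2 l) + dotv ((- b l) *: x + (- c l) *: u + 0 *: z)
    ((- b l) *: x + (- c l) *: u + 0 *: z) + dotv (z2 l) z = 0.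
  apply: (jets_dotv_cst Zj Zj (k := 1)) => l t; have [[_ _ e1] _] := ortho l t.
  by rewrite dotvZl dotvZr e1 mulr1 -expr2.
have UZ : forall l, dotv u (z2 l) + dotv ((- a l) *: x + 0 *: u + c l *: z)
    ((- b l) *: x + (- c l) *: u + 0 *: z) + dotv (u2 l) z = 0.
  apply: (jets_dotv_cst Uj Zj (k := 0)) => l t; have [_ [_ _ e1]] := ortho l t.
  by rewrite dotvZl dotvZr e1 !mulr0.
clearbody x u z a b c.
have {}UU l : dotv (u2 l) u = - ((a l ^+ 2 + c l ^+ 2) / 2).
  have := UU l; rewrite !(dotvDl, dotvDr, dotvZl, dotvZr) (dotvC u (u2 l)).
  rewrite !(dotvC u x) !(dotvC z x) !(dotvC z u) xx uu zz xu xz uz.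
  lra.
have {}ZZ l : dotv (z2 l) z = - ((b l ^+ 2 + c l ^+ 2) / 2).
  have := ZZ l; rewrite !(dotvDl, dotvDr, dotvZl, dotvZr) (dotvC z (z2 l)).
  rewrite !(dotvC u x) !(dotvC z x) !(dotvC z u) xx uu zz xu xz uz.
  lra.
have {}UZ l : dotv (z2 l) u = - dotv (u2 l) z - a l * b l.
  have := UZ l; rewrite !(dotvDl, dotvDr, dotvZl, dotvZr) (dotvC u (z2 l)).
  rewrite !(dotvC u x) !(dotvC z x) !(dotvC z u) xx uu zz xu xz uz.
  lra.
exists (fun l => dotv (u2 l) x), (fun l => dotv (z2 l) x), (fun l => dotv (u2 l) z).
split=> j.
  move: (Uj j) => /jets_ext; apply=> // l.
  by rewrite {1}(expand (u2 l)) UU.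
move: (Zj j) => /jets_ext; apply=> // l.
by rewrite {1}(expand (z2 l)) ZZ UZ.
Qed.

End LineJets.

(** * Expansion of P for a pair of moving lines *)

Section PairForms.
Context {R : realType}.
Implicit Types (M : 'M[R]_3) (v w : R * R * R).

(** [M k l] is the product of the k-th vector of the first frame with the l-th of the second, frames
    being ordered (x, u, z); so S = [M 1 1] and N = [M 2 1 + M 1 2]. In the triples ((a, b), c)
    below, a and b are the components along u and z of the velocity of the point of tangency, and c
    is the rate of rotation about x. *)
Definition contact_value M : R :=
  11 * (M 2 1 + M 1 2) ^+ 2 - 12 * (1 - M 1 1 ^+ 2).

Definition dot1 M v w : R := - v.1.1 * M 0 1 + v.2 * M 2 1 - w.1.1 * M 1 0 + w.2 * M 1 2.

Definition pairing1 M v w : R :=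
  (- v.1.2 * M 0 1 - v.2 * M 1 1 - w.1.1 * M 2 0 + w.2 * M 2 2) +
  (- v.1.1 * M 0 2 + v.2 * M 2 2 - w.1.2 * M 1 0 - w.2 * M 1 1).

Definition contact_deriv M v w : R :=
  22 * (M 2 1 + M 1 2) * pairing1 M v w + 24 * M 1 1 * dot1 M v w.

(** [dot2] and [pairing2] are the t^2-coefficients of S and N with the three free second order terms
    of each line set to 0. *)
Definition dot2 M v w : R :=
  - ((v.1.1 ^+ 2 + v.2 ^+ 2) / 2) * M 1 1 - ((w.1.1 ^+ 2 + w.2 ^+ 2) / 2) * M 1 1
  + (v.1.1 * w.1.1 * M 0 0 - v.1.1 * w.2 * M 0 2 - v.2 * w.1.1 * M 2 0
     + v.2 * w.2 * M 2 2).

Definition pairing2 M v w : R :=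
  (- (v.1.1 * v.1.2) * M 1 1 - ((v.1.2 ^+ 2 + v.2 ^+ 2) / 2) * M 2 1
   + (v.1.2 * w.1.1 * M 0 0 - v.1.2 * w.2 * M 0 2 + v.2 * w.1.1 * M 1 0
      - v.2 * w.2 * M 1 2) - ((w.1.1 ^+ 2 + w.2 ^+ 2) / 2) * M 2 1) +
  (- ((v.1.1 ^+ 2 + v.2 ^+ 2) / 2) * M 1 2
   + (v.1.1 * w.1.2 * M 0 0 + v.1.1 * w.2 * M 0 1 - v.2 * w.1.2 * M 2 0
      - v.2 * w.2 * M 2 1)
   - w.1.1 * w.1.2 * M 1 1 - ((w.1.2 ^+ 2 + w.2 ^+ 2) / 2) * M 1 2).

Definition contact_hess M v w : R :=
  11 * (pairing1 M v w ^+ 2 + 2 * (M 2 1 + M 1 2) * pairing2 M v w) +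
  12 * (dot1 M v w ^+ 2 + 2 * M 1 1 * dot2 M v w).

Definition gram (F G : 'I_3 -> 'rV[R]_3) : 'M[R]_3 :=
  \matrix_(k, l) dotv (F k) (G l).

Section Jets.
Context {V : normedModType R}.

Definition frame_jets (F : 'I_3 -> 'rV[R]_3) (U Z : V -> R -> 'rV[R]_3)
    (w w2 : V -> R * R * R) : Prop :=
  vjets U (F 1)
    (fun l => (- (w l).1.1) *: F 0 + 0 *: F 1 + (w l).2 *: F 2)
    (fun l => (- (w2 l).1.1) *: F 0 + (- (((w l).1.1 ^+ 2 + (w l).2 ^+ 2) / 2)) *: F 1
              + (w2 l).2 *: F 2) /\
  vjets Z (F 2)
    (fun l => (- (w l).1.2) *: F 0 + (- (w l).2) *: F 1 + 0 *: F 2)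
    (fun l => (- (w2 l).1.2) *: F 0
              + (- (w2 l).2 - (w l).1.1 * (w l).1.2) *: F 1
              + (- (((w l).1.2 ^+ 2 + (w l).2 ^+ 2) / 2)) *: F 2).

(** The free second order terms occupy the same places in the expansion of a frame as the velocity
    does at first order. They contribute linearly, through [contact_deriv]; all the rest is
    quadratic in the velocities. *)
Lemma contact_jets F G U Z U' Z' (v v2 w w2 : V -> R * R * R) :
  frame_jets F U Z v v2 -> frame_jets G U' Z' w w2 ->
  jets (fun l t => 11 * (dotv (Z l t) (U' l t) + dotv (U l t) (Z' l t)) ^+ 2 -
                   12 * (1 - dotv (U l t) (U' l t) ^+ 2))
       (contact_value (gram F G))
       (fun l => contact_deriv (gram F G) (v l) (w l))
       (fun l => contact_hess (gram F G) (v l) (w l) +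
                 contact_deriv (gram F G) (v2 l) (w2 l)).
Proof.
move=> [Uj Zj] [U'j Z'j].
have Nj := jetsD (dotv_jets Zj U'j) (dotv_jets Uj Z'j).
have Sj := dotv_jets Uj U'j.
have Pj := jetsD (jetsM (jets_cst 11) (jetsM Nj Nj))
  (jetsM (jets_cst (-12)) (jetsD (jets_cst 1) (jetsN (jetsM Sj Sj)))).
have gE k l : dotv (F k) (G l) = gram F G k l by rewrite mxE.
apply: jets_ext Pj _ _ _ _ => [l t||l|l]; first ring.
- by rewrite /contact_value !gE; ring.
- rewrite !(dotvDl, dotvDr, dotvZl, dotvZr) !gE.
  by rewrite /contact_deriv /pairing1 /dot1; ring.
- rewrite !(dotvDl, dotvDr, dotvZl, dotvZr) !gE.
  rewrite /contact_deriv /contact_hess /pairing1 /dot1 /pairing2 /dot2.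
  by field.
Qed.

End Jets.

End PairForms.

(** * The configuration C_m *)

Section TrigonometricValues.
Context {R : realType}.

Definition s2 : R := Num.sqrt 2.
Definition s3 : R := Num.sqrt 3.
Definition s5 : R := Num.sqrt 5.
Definition s11 : R := Num.sqrt 11.

Lemma s2_sqr : s2 ^+ 2 = 2. Proof. by rewrite sqr_sqrtr. Qed.
Lemma s3_sqr : s3 ^+ 2 = 3. Proof. by rewrite sqr_sqrtr. Qed.
Lemma s5_sqr : s5 ^+ 2 = 5. Proof. by rewrite sqr_sqrtr. Qed.
Lemma s11_sqr : s11 ^+ 2 = 11. Proof. by rewrite sqr_sqrtr. Qed.

Lemma s2_gt0 : 0 < s2. Proof. by rewrite sqrtr_gt0. Qed.
Lemma s3_gt0 : 0 < s3. Proof. by rewrite sqrtr_gt0. Qed.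
Lemma s5_gt0 : 0 < s5. Proof. by rewrite sqrtr_gt0. Qed.
Lemma s11_gt0 : 0 < s11. Proof. by rewrite sqrtr_gt0. Qed.

Lemma sqrtr_eq (x y : R) : 0 <= x -> x ^+ 2 = y -> Num.sqrt y = x.
Proof. by move=> x0 <-; rewrite sqrtr_sqr ger0_norm. Qed.

Lemma sin_atan (x : R) : sin (atan x) = x * cos (atan x).
Proof.
have c0 : cos (atan x) != 0.
  by rewrite lt0r_neq0// cos_gt0_pihalf// atan_gtNpi2 atan_ltpi2.
by rewrite -[X in _ = X * _](atanK x) /tan divfK.
Qed.

Lemma sqrt3_11 : Num.sqrt (3 / 11) = s3 * s11 / 11.
Proof.
apply: sqrtr_eq; first by rewrite divr_ge0// mulr_ge0// sqrtr_ge0.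
by rewrite expr_div_n exprMn s3_sqr s11_sqr; field.
Qed.

Lemma sin_phi_m : sin (phi_m : R) = s3 * s11 / 11.
Proof.
rewrite /phi_m asinK ?sqrt3_11// -sqrt3_11 in_itv/=.
rewrite (le_trans _ (sqrtr_ge0 _)) ?lerN10//=.
by rewrite -[leRHS]sqrtr1 ler_wsqrtr// ler_pdivrMr// mul1r ler_nat.
Qed.

Lemma cos_phi_m : cos phi_m = 2 * s2 * s11 / 11.
Proof.
rewrite /phi_m cos_asin; last first.
  rewrite (le_trans _ (sqrtr_ge0 _)) ?lerN10//=.
  by rewrite -[leRHS]sqrtr1 ler_wsqrtr// ler_pdivrMr// mul1r ler_nat.
rewrite sqr_sqrtr ?divr_ge0//; apply: sqrtr_eq.
  by rewrite divr_ge0// !mulr_ge0// sqrtr_ge0.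
by rewrite expr_div_n !exprMn s2_sqr s11_sqr; field.
Qed.

Lemma cos_delta_m : cos delta_m = s11 / 4.
Proof.
rewrite /delta_m cos_atan sqr_sqrtr ?divr_ge0//.
rewrite (@sqrtr_eq (4 * s11 / 11)).
- have s0 : s11 != 0 by rewrite lt0r_neq0 ?s11_gt0.
  rewrite (_ : s11 / 4 = s11 ^+ 2 / (4 * s11)); last by field.
  by rewrite s11_sqr; field.
- by rewrite divr_ge0// mulr_ge0// sqrtr_ge0.
- by rewrite expr_div_n exprMn s11_sqr; field.
Qed.

Lemma sin_delta_m : sin delta_m = s5 / 4.
Proof.
rewrite {1}/delta_m sin_atan -/delta_m cos_delta_m.
rewrite (@sqrtr_eq (s5 * s11 / 11)).
- by field: s11_sqr.
- by rewrite divr_ge0// mulr_ge0// sqrtr_ge0.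
- by rewrite expr_div_n exprMn s11_sqr s5_sqr; field.
Qed.

Lemma sqrt15 : Num.sqrt 15 = s3 * s5.
Proof.
apply: sqrtr_eq; first by rewrite mulr_ge0// sqrtr_ge0.
by rewrite exprMn s3_sqr s5_sqr; ring.
Qed.

Lemma cos_kappa_m : cos kappa_m = s3 * s5 / 4.
Proof.
rewrite /kappa_m cosN cos_atan expr_div_n sqr_sqrtr//.
have s0 : s3 * s5 != 0 by rewrite mulf_neq0// lt0r_neq0// ?s3_gt0 ?s5_gt0.
rewrite (@sqrtr_eq (4 * (s3 * s5) / 15)).
- rewrite (_ : s3 * s5 / 4 = (s3 * s5) ^+ 2 / (4 * (s3 * s5)));
    last by move: (s3 * s5) s0 => q q0; field.
  have : (s3 * s5) ^+ 2 = 15 by rewrite exprMn s3_sqr s5_sqr; ring.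
  by move: (s3 * s5) s0 => q q0 ->; field.
- by rewrite divr_ge0// !mulr_ge0// sqrtr_ge0.
- by rewrite expr_div_n !exprMn s3_sqr s5_sqr; field.
Qed.

Lemma sin_kappa_m : sin (kappa_m : R) = - 4^-1.
Proof.
have := cos_kappa_m; rewrite /kappa_m cosN sinN sin_atan sqrt15 => ->.
have s0 : s3 * s5 != 0 by rewrite mulf_neq0// lt0r_neq0// ?s3_gt0 ?s5_gt0.
by rewrite div1r mulrA mulVf// mul1r.
Qed.

Lemma sin_pi6 : sin (pi / 6 : R) = 2^-1.
Proof.
have pi0 := @pi_gt0 R.
have s0 : 0 < sin (pi / 6 : R) by apply: sin_gt0_pi; apply/andP; split; lra.
have : sin (pi / 6 + pi / 6 + pi / 6) = 1 :> R.
  by rewrite (_ : _ + _ = pi / 2) ?sin_pihalf//; field.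
rewrite !(sinD, cosD) => h.
have c2 := cos2sin2 (pi / 6 : R).
(* The triple angle formula turns sin (3 x) = 1 into (s + 1) (2 s - 1)^2 = 0 with s = sin x. *)
have /eqP : (sin (pi / 6) + 1) * (2 * sin (pi / 6) - 1) ^+ 2 = 0 :> R.
  by rewrite -[RHS](subrr 1) -[X in _ = _ - X]h; ring: c2.
rewrite mulf_eq0 expf_eq0/= => /orP[/eqP|/eqP]; lra.
Qed.

Lemma cos_pi6 : cos (pi / 6 : R) = s3 / 2.
Proof.
have pi0 := @pi_gt0 R.
have c0 : 0 < cos (pi / 6 : R) by apply: cos_gt0_pihalf; apply/andP; split; lra.
have := cos2sin2 (pi / 6 : R); rewrite sin_pi6 => c2.
apply/eqP; rewrite -(@eqrXn2 _ 2)// ?(ltW c0) ?divr_ge0 ?sqrtr_ge0//.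
by rewrite c2 expr_div_n s3_sqr; apply/eqP; field.
Qed.

Definition base_angles : 'M[R]_(6, 3) := C6_angles phi_m delta_m kappa_m.

(** With the directions of the last three lines reversed, the half turns that exchange the two
    triples of lines carry frames to frames. *)
Definition side (i : 'I_6) : R := if (i < 3)%N then 1 else -1.

Definition cos_lon (i : 'I_6) : R := nth 0 [:: (3 * s5 - 1) / 8;
  - (3 * s5 + 1) / 8; 1 / 4; 1 / 4; - (3 * s5 + 1) / 8; (3 * s5 - 1) / 8] i.

Definition sin_lon (i : 'I_6) : R := nth 0 [:: (s3 * s5 + s3) / 8;
  (s3 * s5 - s3) / 8; - (s3 * s5) / 4; s3 * s5 / 4;
  (s3 - s3 * s5) / 8; - (s3 * s5 + s3) / 8] i.

Lemma side_sqr i : side i ^+ 2 = 1.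
Proof. by rewrite /side; case: ifP => _; rewrite ?sqrrN expr1n. Qed.

Lemma base_anglesE (i : 'I_6) :
  [/\ cos (base_angles i 0) = 2 * s2 * s11 / 11,
      sin (base_angles i 0) = side i * (s3 * s11 / 11),
      cos (base_angles i 2) = s11 / 4 & sin (base_angles i 2) = s5 / 4] /\
  (cos (base_angles i 1) = cos_lon i /\ sin (base_angles i 1) = sin_lon i).
Proof.
have cD := @cosDpi R; have sD := @sinDpi R.
have [c2 s2'] := (@cos_pihalf R, @sin_pihalf R).
have [c6 s6] : cos (5 * pi / 6) = - (s3 / 2) :> R /\ sin (5 * pi / 6) = 2^-1 :> R.
  have -> : 5 * pi / 6 = - (pi / 6) + pi :> R by field.
  by rewrite cD sD cosN sinN cos_pi6 sin_pi6 opprK.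
have [c32 s32] : cos (3 * pi / 2) = 0 :> R /\ sin (3 * pi / 2) = - 1 :> R.
  have -> : 3 * pi / 2 = pi / 2 + pi :> R by field.
  by rewrite cD sD c2 s2' oppr0.
have [c76 s76] : cos (7 * pi / 6) = - (s3 / 2) :> R /\
    sin (7 * pi / 6) = - 2^-1 :> R.
  have -> : 7 * pi / 6 = pi / 6 + pi :> R by field.
  by rewrite cD sD cos_pi6 sin_pi6.
have [c116 s116] : cos (11 * pi / 6) = s3 / 2 :> R /\
    sin (11 * pi / 6) = - 2^-1 :> R.
  have -> : 11 * pi / 6 = - (pi / 6) + pi + pi :> R by field.
  by rewrite !cD !sD !opprK cosN sinN cos_pi6 sin_pi6.
rewrite /base_angles /C6_angles /side /cos_lon /sin_lon !mxE.
move: kappa_m (@cos_kappa_m) (@sin_kappa_m) => kappa ck sk.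
case: i => [[|[|[|[|[|[|]]]]]] ?] //=; split;
  do ?[by rewrite ?cosN ?sinN cos_phi_m sin_phi_m cos_delta_m sin_delta_m
          ?mul1r ?mulN1r];
  split; rewrite !(cosB, sinB, cosD, sinD) ck sk ?(c2, s2', c6, s6, c32, s32)
    ?(c76, s76, c116, s116) ?cos_pi6 ?sin_pi6; by field: s3_sqr.
Qed.

End TrigonometricValues.

(** * Gram matrices of the frames at the pairs of lines *)

Section ContactGraph.
Context {R : realType}.
Implicit Types (i j : 'I_6) (k : 'I_3).
Local Notation s2 := (@s2 R).
Local Notation s3 := (@s3 R).
Local Notation s5 := (@s5 R).
Local Notation s11 := (@s11 R).

Definition frame i k : 'rV[R]_3 :=
  let p := base_angles i 0 in let q := base_angles i 1 in
  let d := base_angles i 2 in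
  nth 0 [:: sphere_point p q; side i *: direction p q d; side i *: conormal p q d] k.

(* With (e_r, e_k, e_z) the cylindrical basis at the longitude of the i-th line,
   the k-th frame vector is rad k e_r + side i (tng k e_k + alt k e_z). *)
Let rad k : R := nth 0 [:: 2 * s2 * s11 / 11; - (s3 / 4); - (s3 * s5 * s11 / 44)] k.
Let tng k : R := nth 0 [:: 0; s5 / 4; - (s11 / 4)] k.
Let alt k : R := nth 0 [:: s3 * s11 / 11; s2 / 2; s2 * s5 * s11 / 22] k.

Lemma frameE i k : frame i k =
  vec3 (rad k * cos_lon i - side i * tng k * sin_lon i)
       (rad k * sin_lon i + side i * tng k * cos_lon i) (side i * alt k).
Proof.
have s1 := @side_sqr R i; have h11 := @s11_sqr R.
have [[cp sp cd sd] [ck sk]] := @base_anglesE R i.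
rewrite /frame directionE /sphere_point /conormal !scale_vec3 cp sp cd sd ck sk.
rewrite /rad /tng /alt.
by case: k => [[|[|[|]]] ?] //=; congr vec3; field: s1 h11.
Qed.

(** [c] and [s] are the cosine and sine of the difference of the longitudes, [a] and [b] the sides
    of the two lines. *)
Definition gram_lon (c s a b : R) : 'M[R]_3 := \matrix_(k, l)
  (rad k * rad l * c - b * rad k * tng l * s + a * tng k * rad l * s +
   a * b * tng k * tng l * c + a * b * alt k * alt l).

Definition lon_cos i j : R := cos_lon i * cos_lon j + sin_lon i * sin_lon j.
Definition lon_sin i j : R := cos_lon i * sin_lon j - sin_lon i * cos_lon j.

Lemma gram_frame i j :
  gram (frame i) (frame j) = gram_lon (lon_cos i j) (lon_sin i j) (side i) (side j).
Proof.
apply/matrixP => k l.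
rewrite !mxE dotvE !frameE !vec3E /lon_cos /lon_sin; ring.
Qed.

Definition mx3 (rows : seq (seq R)) : 'M[R]_3 :=
  \matrix_(k, l) nth 0 (nth [::] rows k) l.

(* Up to the symmetries of C_m there are three kinds of pairs of lines at
   minimal distance. The kinds 1 and 2 are exchanged by s5 |-> - s5. *)
Definition contact_gram (n : nat) : 'M[R]_3 :=
  let s66 := s2 * s3 * s11 in
  let s30 := s2 * s3 * s5 in
  let s55 := s5 * s11 in
  nth 0 [::
    mx3 [:: [:: - (1 / 11); s66 * (3 - s5) / 44; s30 * (3 / 44 + s5 / 20)];
            [:: s66 * (3 + s5) / 44; 1 / 4; s55 * (3 / 44 - 3 * s5 / 110)];
            [:: s30 * (3 / 44 - s5 / 20); s55 * (3 / 44 + 3 * s5 / 110); - (7 / 44)]];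
    mx3 [:: [:: (1 + 3 * s5) / 22; - (s66 * (7 - s5) / 88);
                - (s30 * (3 / 88 + 23 * s5 / 440))];
            [:: - (s66 * (7 - s5) / 88); - ((7 + 3 * s5) / 16);
                - (s55 * (3 / 176 - 21 * s5 / 880))];
            [:: - (s30 * (3 / 88 + 23 * s5 / 440));
                - (s55 * (3 / 176 - 21 * s5 / 880)); - ((107 - 9 * s5) / 176)]];
    mx3 [:: [:: (1 - 3 * s5) / 22; - (s66 * (7 + s5) / 88);
                - (s30 * (3 / 88 - 23 * s5 / 440))];
            [:: - (s66 * (7 + s5) / 88); - ((7 - 3 * s5) / 16);
                - (s55 * (3 / 176 + 21 * s5 / 880))];
            [:: - (s30 * (3 / 88 - 23 * s5 / 440));
                - (s55 * (3 / 176 + 21 * s5 / 880)); - ((107 + 9 * s5) / 176)]]] n.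

Lemma gram_lon0 a : a ^+ 2 = 1 ->
  gram_lon (- (1 / 2)) (a * (s3 / 2)) a a = contact_gram 0.
Proof.
move=> a1; have h2 := @s2_sqr R; have h3 := @s3_sqr R; have h5 := @s5_sqr R.
have h11 := @s11_sqr R.
apply/matrixP => k l; rewrite !mxE /rad /tng /alt.
by case: k => [[|[|[|]]] ?] //=; case: l => [[|[|[|]]] ?] //=;
  field: a1 h2 h3 h5 h11.
Qed.

Lemma gram_lon1 :
  gram_lon ((7 + 3 * s5) / 16) ((7 * s3 - s3 * s5) / 16) 1 (-1) = contact_gram 1.
Proof.
have h2 := @s2_sqr R; have h3 := @s3_sqr R; have h5 := @s5_sqr R.
have h11 := @s11_sqr R.
apply/matrixP => k l; rewrite !mxE /rad /tng /alt.
by case: k => [[|[|[|]]] ?] //=; case: l => [[|[|[|]]] ?] //=;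
  field: h2 h3 h5 h11.
Qed.

Lemma gram_lon2 :
  gram_lon ((7 - 3 * s5) / 16) (- (7 * s3 + s3 * s5) / 16) 1 (-1) = contact_gram 2.
Proof.
have h2 := @s2_sqr R; have h3 := @s3_sqr R; have h5 := @s5_sqr R.
have h11 := @s11_sqr R.
apply/matrixP => k l; rewrite !mxE /rad /tng /alt.
by case: k => [[|[|[|]]] ?] //=; case: l => [[|[|[|]]] ?] //=;
  field: h2 h3 h5 h11.
Qed.

(** The order inside a pair of kind 0 matters, because its Gram matrix is not symmetric: longitudes
    advance by 2 pi / 3 in the first triple and go back by as much in the second. *)
Definition contacts : seq (nat * ('I_6 * 'I_6)) :=
  [:: (0%N, (0, 1)); (0%N, (1, 2)); (0%N, (2, 0)); (0%N, (4, 3)); (0%N, (5, 4)); (0%N, (3, 5));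
      (1%N, (0, 3)); (1%N, (1, 4)); (1%N, (2, 5));
      (2%N, (0, 5)); (2%N, (1, 3)); (2%N, (2, 4))].

Definition far_pairs : seq ('I_6 * 'I_6) := [:: (0, 4); (1, 5); (2, 3)].

Lemma gram_contact c : c \in contacts ->
  gram (frame c.2.1) (frame c.2.2) = contact_gram c.1.
Proof.
have h3 := @s3_sqr R; have h5 := @s5_sqr R.
rewrite gram_frame !inE.
do 12?[case/orP]; move=> /eqP-> /=; rewrite /lon_cos /lon_sin;
  (first [rewrite -(gram_lon0 (side_sqr 0)) | rewrite -gram_lon1 | rewrite -gram_lon2]);
  first [by congr gram_lon; rewrite ?/side ?/cos_lon ?/sin_lon //=; field: h3 h5
        | rewrite (gram_lon0 (side_sqr 0)) -(gram_lon0 (side_sqr 3));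
          by congr gram_lon; rewrite ?/side ?/cos_lon ?/sin_lon //=; field: h3 h5].
Qed.

Lemma contact_gram_value n : (n < 3)%N -> contact_value (contact_gram n) = 0.
Proof.
have h5 := @s5_sqr R; have h11 := @s11_sqr R.
case: n => [|[|[|]]] // _; rewrite /contact_value /contact_gram !mxE /=;
  by field: h5 h11.
Qed.

Lemma contact_gram_le n : (n < 3)%N -> (contact_gram n) 1 1 ^+ 2 <= 3 / 4.
Proof.
have h5 := @s5_sqr R; have s50 := @s5_gt0 R.
(* For kind 1 the bound ((7 + 3 s5) / 16)^2 <= 3 / 4 amounts to s5 <= 7 / 3. *)
have s5u : s5 < 7 / 3.
  by rewrite ltNge; apply/negP => s53; nra.
case: n => [|[|[|]]] // _; rewrite /contact_gram !mxE /=; nra.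
Qed.

Lemma far_pair_gram c : c \in far_pairs ->
  0 < contact_value (gram (frame c.1) (frame c.2)) /\
  gram (frame c.1) (frame c.2) 1 1 ^+ 2 <= 3 / 4.
Proof.
have h2 := @s2_sqr R; have h3 := @s3_sqr R; have h5 := @s5_sqr R.
have h11 := @s11_sqr R.
move=> cfar.
have -> : gram (frame c.1) (frame c.2) = gram_lon (- (7 / 8)) (s3 * s5 / 8) 1 (-1).
  move: cfar; rewrite gram_frame !inE.
  by do 2?[case/orP]; move=> /eqP-> /=; rewrite /lon_cos /lon_sin;
    congr gram_lon; rewrite ?/side ?/cos_lon ?/sin_lon //=; field: h3 h5.
have v18 : contact_value (gram_lon (- (7 / 8)) (s3 * s5 / 8) 1 (-1)) = 18.
  by rewrite /contact_value !mxE /rad /tng /alt /=; field: h2 h3 h5 h11.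
have g11 : gram_lon (- (7 / 8)) (s3 * s5 / 8) 1 (-1) 1 1 = - (5 / 8).
  by rewrite !mxE /rad /tng /alt /=; field: h2 h3 h5 h11.
by rewrite v18 g11 ltr0n; split=> //; lra.
Qed.

Lemma contacts_cover (P : 'I_6 -> 'I_6 -> Prop) :
  (forall i j, P i j -> P j i) ->
  {in contacts, forall c, P c.2.1 c.2.2} -> {in far_pairs, forall c, P c.1 c.2} ->
  forall i j, (i < j)%N -> P i j.
Proof.
move=> Psym Pc Pf i j ij.
have : has (fun c => (c.2 == (i, j)) || (c.2 == (j, i))) contacts ||
    ((i, j) \in far_pairs).
  by move: ij; case: i => [[|[|[|[|[|[|]]]]]] ?] //;
    case: j => [[|[|[|[|[|[|]]]]]] ?].
case/orP => [/hasP[c cc /orP[/eqP cE|/eqP cE]]|ijf].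
- by have := Pc _ cc; rewrite cE.
- by have := Pc _ cc; rewrite cE => /Psym.
- exact: (Pf _ ijf).
Qed.

End ContactGraph.

(** * Equilibrium stress and second variation *)

Section Equilibrium.
Context {R : realType}.
Implicit Types (v w : R * R * R).
Local Notation s2 := (@s2 R).
Local Notation s3 := (@s3 R).
Local Notation s5 := (@s5 R).
Local Notation s11 := (@s11 R).

(* In the rescaled velocity components all the equations have coefficients in
   Q(s5). *)
Definition rescale w : R * R * R :=
  (s2 * s3 * s11 * w.1.1, s2 * s3 * s5 * w.1.2, s5 * s11 * w.2).

Definition unscale w : R * R * R :=
  (w.1.1 / (s2 * s3 * s11), w.1.2 / (s2 * s3 * s5), w.2 / (s5 * s11)).

Lemma unscaleK w : rescale (unscale w) = w.
Proof.
have [n2 n3 n5 n11] : [/\ s2 != 0, s3 != 0, s5 != 0 & s11 != 0].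
  by split; rewrite lt0r_neq0// ?s2_gt0 ?s3_gt0 ?s5_gt0 ?s11_gt0.
case: w => [[a b] c]; rewrite /rescale /unscale /=.
by congr (_, _, _); rewrite mulrC divfK ?mulf_neq0.
Qed.

(** The derivative at a contact is a sum of one linear form for each line: fX - s5 fY and fX + s5 fY
    for kind 0, fU s5 for kind 1, fU (- s5) for kind 2. These are four forms on a space of dimension
    3. *)
Definition fX w : R := 21 * w.1.1 + 15 * w.1.2 + 10 * w.2.
Definition fY w : R := - 9 * w.1.1 + 5 * w.1.2 + 2 * w.2.
Definition fU (r : R) w : R :=
  39 * w.1.1 - 35 * w.1.2 + 50 * w.2 - r * (15 * w.1.1 - 27 * w.1.2 + 26 * w.2).

Lemma contact_deriv0 v w : contact_deriv (contact_gram 0) (rescale v) (rescale w) =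
  - (9 / 2) * ((fX v - s5 * fY v) + (fX w + s5 * fY w)).
Proof.
have h2 := @s2_sqr R; have h3 := @s3_sqr R; have h5 := @s5_sqr R.
have h11 := @s11_sqr R.
rewrite /contact_deriv /pairing1 /dot1 /contact_gram !mxE /= /fX /fY.
by field: h2 h3 h5 h11.
Qed.

Lemma contact_deriv1 v w : contact_deriv (contact_gram 1) (rescale v) (rescale w) =
  9 / 8 * (fU s5 v + fU s5 w).
Proof.
have h2 := @s2_sqr R; have h3 := @s3_sqr R; have h5 := @s5_sqr R.
have h11 := @s11_sqr R.
rewrite /contact_deriv /pairing1 /dot1 /contact_gram !mxE /= /fU.
by field: h2 h3 h5 h11.
Qed.

Lemma contact_deriv2 v w : contact_deriv (contact_gram 2) (rescale v) (rescale w) =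
  9 / 8 * (fU (- s5) v + fU (- s5) w).
Proof.
have h2 := @s2_sqr R; have h3 := @s3_sqr R; have h5 := @s5_sqr R.
have h11 := @s11_sqr R.
rewrite /contact_deriv /pairing1 /dot1 /contact_gram !mxE /= /fU.
by field: h2 h3 h5 h11.
Qed.

(* The unique linear relation between the derivatives of the twelve minimal
   distances; that it has positive coefficients makes C_m critical. *)
Definition stress (n : nat) : R := nth 0 [:: 1; 6 + 2 * s5; 6 - 2 * s5] n.

Lemma s5_lt3 : s5 < 3.
Proof. by have h5 := @s5_sqr R; rewrite ltNge; apply/negP => s53; nra. Qed.

Lemma stress_gt0 n : (n < 3)%N -> 0 < stress n.
Proof.
have := s5_lt3; have := @s5_gt0 R.
by case: n => [|[|[|]]] // ? ? _; rewrite /stress /=; lra.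
Qed.

Lemma stress_sum : \sum_(c <- contacts) stress c.1 = 42.
Proof. by rewrite /contacts !big_cons big_nil /stress /=; ring. Qed.

(** The stress balances line by line. Each line is once the first and once the second member of a
    contact of kind 0, and lies in one contact of each other kind; its total contribution is 9 / 4
    times - 4 fX + (3 + s5) fU s5 + (3 - s5) fU (- s5), which is the relation between its four
    forms. *)
Lemma equilibrium (w : 'I_6 -> R * R * R) :
  \sum_(c <- contacts) stress c.1 *
    contact_deriv (contact_gram c.1) (w c.2.1) (w c.2.2) = 0.
Proof.
have h5 := @s5_sqr R.
pose w' i := unscale (w i).
under eq_bigr do rewrite -(unscaleK (w _)) -(unscaleK (w _.2.2)).
rewrite /contacts !big_cons big_nil /= !(contact_deriv0, contact_deriv1, contact_deriv2).
rewrite /stress /= /fX /fY /fU -!/(w' _); by field: h5.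
Qed.

(* The general solution of the twelve equations contact_deriv = 0 with the first
   line fixed: fX + s5 fY and fX - s5 fY link the lines of one side, fU the two
   sides, and 4 fX = (3 + s5) fU s5 + (3 - s5) fU (- s5). The equations give
   fY (w 1) = fY (w 2) =: y; the other parameters are e := fY (w 4) and suitable
   multiples f, g of fU (- s5) (w 1), fU s5 (w 2). *)
Definition flex (y f g e : R) (i : 'I_6) : R * R * R :=
  let r := s5 in
  nth (0, 0, 0) [:: (0, 0, 0);
    (- (115 + 29 * r) / 1584 * y - 5 / 792 * f,
     (1 - r) / 48 * y - f / 24,
     (4 - r) / 33 * y + 5 / 66 * f);
    (5 / 792 * g - (115 - 29 * r) / 1584 * y,
     g / 24 + (1 + r) / 48 * y,
     - (5 / 66) * g + (4 + r) / 33 * y);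
    ((5 - 29 * r) / 1584 * f - 5 / 72 * (e - g),
     (1 - r) / 48 * f + (e - g) / 24,
     - (5 + 4 * r) / 132 * f + (e - g) / 12);
    (5 / 792 * y + (5 + 29 * r) / 1584 * f - (5 - 29 * r) / 1584 * g - 5 / 72 * e,
     y / 24 + (1 + r) / 48 * f - (1 - r) / 48 * g + e / 24,
     - (5 / 66) * y - (5 - 4 * r) / 132 * f + (5 + 4 * r) / 132 * g + e / 12);
    (- (5 + 29 * r) / 1584 * g - 5 / 72 * (e + f),
     - (1 + r) / 48 * g + (e + f) / 24,
     (5 - 4 * r) / 132 * g + (e + f) / 12)] i.

Lemma contact_deriv_flex y f g e c : c \in contacts ->
  contact_deriv (contact_gram c.1) (rescale (flex y f g e c.2.1))
    (rescale (flex y f g e c.2.2)) = 0.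
Proof.
have h5 := @s5_sqr R.
rewrite !inE; do 12?[case/orP]; move=> /eqP-> /=;
  rewrite (contact_deriv0, contact_deriv1, contact_deriv2) /fX /fY /fU /flex /=;
  by field: h5.
Qed.

Lemma flexP (w : 'I_6 -> R * R * R) : w 0 = (0, 0, 0) ->
  {in contacts, forall c, contact_deriv (contact_gram c.1) (rescale (w c.2.1))
    (rescale (w c.2.2)) = 0} ->
  forall i, w i = flex (fY (w 1)) ((3 - s5) * s5 / 20 * fU (- s5) (w 1))
    ((3 + s5) * s5 / 20 * fU s5 (w 2)) (fY (w 4)) i.
Proof.
have h5 := @s5_sqr R.
move=> w0 wc.
have k0 i j : (0%N, (i, j)) \in contacts ->
    (fX (w i) - s5 * fY (w i)) + (fX (w j) + s5 * fY (w j)) = 0.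
  by move=> /wc /=; rewrite contact_deriv0; lra.
have k1 i j : (1%N, (i, j)) \in contacts -> fU s5 (w i) + fU s5 (w j) = 0.
  by move=> /wc /=; rewrite contact_deriv1; lra.
have k2 i j : (2%N, (i, j)) \in contacts -> fU (- s5) (w i) + fU (- s5) (w j) = 0.
  by move=> /wc /=; rewrite contact_deriv2; lra.
have XU v : fX v = (3 + s5) / 4 * fU s5 v + (3 - s5) / 4 * fU (- s5) v.
  by rewrite /fX /fU; field: h5.
have coord v : v = (23 / 1584 * (fU (- s5) v + fU s5 v)
    - s5 / 198 * (fU (- s5) v - fU s5 v) - 5 / 72 * fY v,
    (fU (- s5) v + fU s5 v) / 48 - s5 / 120 * (fU (- s5) v - fU s5 v) + fY v / 24,
    7 / 528 * (fU (- s5) v + fU s5 v) - s5 / 528 * (fU (- s5) v - fU s5 v)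
    + fY v / 12).
  by case: v => [[a b] c]; rewrite /fU /fY /=; congr (_, _, _); field: h5.
have [U0 V0 Y0] : [/\ fU s5 (w 0) = 0, fU (- s5) (w 0) = 0 & fY (w 0) = 0].
  by rewrite w0 /fU /fY /=; split; ring.
(* [k] is the factor by which the equation e = 0 is multiplied to isolate an unknown: below, s5 / 5
   is the inverse of s5, and 3 - s5 that of (3 + s5) / 4. *)
have elim (k e a b : R) : e = 0 -> a - b = k * e -> a = b.
  by move=> -> /eqP; rewrite mulr0 subr_eq0 => /eqP.
have U3 : fU s5 (w 3) = 0 by have := k1 0 3 isT; rewrite U0; lra.
have V5 : fU (- s5) (w 5) = 0 by have := k2 0 5 isT; rewrite V0; lra.
have U4 : fU s5 (w 4) = - fU s5 (w 1) by have := k1 1 4 isT; lra.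
have U5 : fU s5 (w 5) = - fU s5 (w 2) by have := k1 2 5 isT; lra.
have V3 : fU (- s5) (w 3) = - fU (- s5) (w 1) by have := k2 1 3 isT; lra.
have V4 : fU (- s5) (w 4) = - fU (- s5) (w 2) by have := k2 2 4 isT; lra.
have e01 : fX (w 1) + s5 * fY (w 1) = 0.
  by have := k0 0 1 isT; rewrite XU U0 V0 Y0; lra.
have e20 : fX (w 2) - s5 * fY (w 2) = 0.
  by have := k0 2 0 isT; rewrite [fX (w 0)]XU U0 V0 Y0; lra.
have Y2 : fY (w 2) = fY (w 1).
  have e12 : s5 * (fY (w 2) - fY (w 1)) = 0 by have := k0 1 2 isT; lra.
  by apply: (elim (s5 / 5) _ _ _ e12); field: h5.
have e43 := k0 4 3 isT; have e54 := k0 5 4 isT.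
have U1 : fU s5 (w 1) =
    (3 - s5) * (- s5 * fY (w 1) - (3 - s5) / 4 * fU (- s5) (w 1)).
  by move: e01; rewrite XU => /(elim (3 - s5)); apply; field: h5.
have V2 : fU (- s5) (w 2) =
    (3 + s5) * (s5 * fY (w 1) - (3 + s5) / 4 * fU s5 (w 2)).
  by move: e20; rewrite XU Y2 => /(elim (3 + s5)); apply; field: h5.
have Y3 : fY (w 3) = fY (w 4) - s5 / 5 * (fX (w 3) + fX (w 4)).
  by apply: (elim (s5 / 5) _ _ _ e43); field: h5.
have Y5 : fY (w 5) = fY (w 4) + s5 / 5 * (fX (w 4) + fX (w 5)).
  by apply: (elim (- s5 / 5) _ _ _ e54); field: h5.
move: Y2 Y3 Y5.
rewrite !XU U3 V5 U4 U5 V3 V4 V2 U1 => Y2 Y3 Y5.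
move=> i; case: i => [[|[|[|[|[|[|]]]]]] lt_i] //.
- by rewrite (_ : Ordinal _ = 0) ?w0//; exact: val_inj.
- rewrite (_ : Ordinal _ = 1); last exact: val_inj.
  rewrite [LHS]coord U1 /flex /=;
    by congr (_, _, _); field: h5.
- rewrite (_ : Ordinal _ = 2); last exact: val_inj.
  rewrite [LHS]coord V2 Y2 /flex /=;
    by congr (_, _, _); field: h5.
- rewrite (_ : Ordinal _ = 3); last exact: val_inj.
  rewrite [LHS]coord Y3 U3 V3 /flex /=;
    by congr (_, _, _); field: h5.
- rewrite (_ : Ordinal _ = 4); last exact: val_inj.
  rewrite [LHS]coord U4 V4 V2 U1 /flex /=;
    by congr (_, _, _); field: h5.
- rewrite (_ : Ordinal _ = 5); last exact: val_inj.
  rewrite [LHS]coord Y5 U5 V5 /flex /=;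
    by congr (_, _, _); field: h5.
Qed.

(* Halves of the Hessian of a contact of the first kind in the coordinates
   fU s5, fU (- s5), fY, which are the ones that are simple on flex. *)
Definition self0 (r : R) w : R :=
  let u := fU r w in let u' := fU (- r) w in let y := fY w in
  (185 + 35 * r) / 192 * y ^+ 2 - (285 + 83 * r) / 192 * (y * u) +
  (85 - 69 * r) / 192 * (y * u') + (131 * r - 95) / 8448 * u ^+ 2 +
  (7 + 25 * r) / 384 * (u * u') + (91 * r - 43) / 8448 * u' ^+ 2.

Definition cross0 (r : R) v w : R :=
  - (295 / 24) * (fY v * fY w) - (155 + 53 * r) / 96 * (fY v * fU r w) -
  (125 + r) / 96 * (fY v * fU (- r) w) - (125 - r) / 96 * (fY w * fU r v) -
  (155 - 53 * r) / 96 * (fY w * fU (- r) v) +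
  (15 + 10 * r) / 96 * (fU r v * fU r w) - 1 / 3 * (fU r v * fU (- r) w) +
  5 / 48 * (fU (- r) v * fU r w) + (15 - 10 * r) / 96 * (fU (- r) v * fU (- r) w).

Definition self1 (r : R) w : R :=
  let u := fU r w in let u' := fU (- r) w in let y := fY w in
  - (3065 + 1715 * r) / 768 * y ^+ 2 - (855 + 169 * r) / 768 * (y * u) +
  (393 * r - 1585) / 768 * (y * u') + (1513 + 719 * r) / 3072 * u ^+ 2 +
  (185 * r - 109) / 1536 * (u * u') +
  (4523 * r - 10739) / (96 * 352) * u' ^+ 2.

Definition cross1 (r : R) v w : R :=
  (265 + 245 * r) / 48 * (fY v * fY w) +
  (39 * r - 95) / 192 * (fY v * fU r w + fY w * fU r v) +
  (26 * r - 45 / 2) / 48 * (fY v * fU (- r) w + fY w * fU (- r) v) +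
  (100 + 43 * r) / 96 * (fU r v * fU r w) +
  (109 - 7 * r) / 384 * (fU r v * fU (- r) w + fU r w * fU (- r) v) +
  (205 - 89 * r) / 192 * (fU (- r) v * fU (- r) w).

Lemma contact_hess0 v w : contact_hess (contact_gram 0) (rescale v) (rescale w) =
  self0 s5 v + self0 (- s5) w + cross0 s5 v w.
Proof.
have h2 := @s2_sqr R; have h3 := @s3_sqr R; have h5 := @s5_sqr R.
have h11 := @s11_sqr R.
rewrite /contact_hess /pairing1 /pairing2 /dot1 /dot2 /contact_gram !mxE /rescale /=.
by rewrite /self0 /cross0 /fU /fY; field: h2 h3 h5 h11.
Qed.

Lemma contact_hess1 v w : contact_hess (contact_gram 1) (rescale v) (rescale w) =
  self1 s5 v + self1 s5 w + cross1 s5 v w.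
Proof.
have h2 := @s2_sqr R; have h3 := @s3_sqr R; have h5 := @s5_sqr R.
have h11 := @s11_sqr R.
rewrite /contact_hess /pairing1 /pairing2 /dot1 /dot2 /contact_gram !mxE /rescale /=.
by rewrite /self1 /cross1 /fU /fY; field: h2 h3 h5 h11.
Qed.

Lemma contact_hess2 v w : contact_hess (contact_gram 2) (rescale v) (rescale w) =
  self1 (- s5) v + self1 (- s5) w + cross1 (- s5) v w.
Proof.
have h2 := @s2_sqr R; have h3 := @s3_sqr R; have h5 := @s5_sqr R.
have h11 := @s11_sqr R.
rewrite /contact_hess /pairing1 /pairing2 /dot1 /dot2 /contact_gram !mxE /rescale /=.
by rewrite /self1 /cross1 /fU /fY; field: h2 h3 h5 h11.
Qed.

(* The part of the stress-weighted Hessian that involves a single line; by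
   symmetry it is the same for all the lines. *)
Definition self w : R :=
  let u := fU s5 w in let u' := fU (- s5) w in let y := fY w in
  (603 + 285 * s5) / 128 * u ^+ 2 + (603 - 285 * s5) / 128 * u' ^+ 2 +
  51 / 32 * (u * u') - (275 + 41 * s5) / 16 * (y * u) -
  (275 - 41 * s5) / 16 * (y * u') - 725 / 8 * y ^+ 2.

Lemma selfE w : self w = self0 s5 w + self0 (- s5) w +
  (6 + 2 * s5) * self1 s5 w + (6 - 2 * s5) * self1 (- s5) w.
Proof.
have h5 := @s5_sqr R; rewrite /self /self0 /self1 opprK.
by move: (fU s5 w) (fU (- s5) w) (fY w) => u u' y; field: h5.
Qed.

Lemma flex_coords (y f g e : R) :
  [/\ fU s5 (flex y f g e 0) = 0, fU (- s5) (flex y f g e 0) = 0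
    & fY (flex y f g e 0) = 0] /\
  [/\ fU s5 (flex y f g e 1) = (5 - 3 * s5) * (y + f),
      fU (- s5) (flex y f g e 1) = (5 + 3 * s5) * f & fY (flex y f g e 1) = y] /\
  [/\ fU s5 (flex y f g e 2) = (3 * s5 - 5) * g,
      fU (- s5) (flex y f g e 2) = (5 + 3 * s5) * (y - g)
    & fY (flex y f g e 2) = y] /\
  [/\ fU s5 (flex y f g e 3) = 0,
      fU (- s5) (flex y f g e 3) = - (5 + 3 * s5) * f
    & fY (flex y f g e 3) = e - g] /\
  [/\ fU s5 (flex y f g e 4) = (3 * s5 - 5) * (y + f),
      fU (- s5) (flex y f g e 4) = (5 + 3 * s5) * (g - y)
    & fY (flex y f g e 4) = e] /\
  [/\ fU s5 (flex y f g e 5) = (5 - 3 * s5) * g,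
      fU (- s5) (flex y f g e 5) = 0 & fY (flex y f g e 5) = e + f].
Proof.
have h5 := @s5_sqr R.
by rewrite /fU /fY /flex /=; do ?split; field: h5.
Qed.

Lemma hess_flex (y f g e : R) :
  \sum_(c <- contacts) stress c.1 * contact_hess (contact_gram c.1)
    (rescale (flex y f g e c.2.1)) (rescale (flex y f g e c.2.2)) =
  - (3465 / 8) * y ^+ 2 + (105 * s5 - 95 / 2) * (f * y) +
  (105 * s5 + 95 / 2) * (g * y) - 1145 / 8 * (f ^+ 2 + g ^+ 2) -
  535 / 4 * (f * g) - 75 / 4 * (e * f) + 75 / 4 * (e * g) - 1235 / 4 * e ^+ 2 +
  2095 / 4 * (e * y).
Proof.
have h5 := @s5_sqr R.
have [[u0 v0 y0] [[u1 v1 y1] [[u2 v2 y2] [[u3 v3 y3] [[u4 v4 y4] [u5 v5 y5]]]]]] :=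
  flex_coords y f g e.
move: (flex y f g e) u0 v0 y0 u1 v1 y1 u2 v2 y2 u3 v3 y3 u4 v4 y4 u5 v5 y5 => w
  u0 v0 y0 u1 v1 y1 u2 v2 y2 u3 v3 y3 u4 v4 y4 u5 v5 y5.
(* The parts involving a single line are collected into [self]; the mixed parts remain grouped by
   kind of contact. *)
transitivity (self (w 0) + self (w 1) + self (w 2) + self (w 3) + self (w 4) +
  self (w 5) + (cross0 s5 (w 0) (w 1) + cross0 s5 (w 1) (w 2) + cross0 s5 (w 2) (w 0)
  + cross0 s5 (w 4) (w 3) + cross0 s5 (w 5) (w 4) + cross0 s5 (w 3) (w 5)) +
  (6 + 2 * s5) * (cross1 s5 (w 0) (w 3) + cross1 s5 (w 1) (w 4) +
    cross1 s5 (w 2) (w 5)) +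
  (6 - 2 * s5) * (cross1 (- s5) (w 0) (w 5) + cross1 (- s5) (w 1) (w 3) +
    cross1 (- s5) (w 2) (w 4))).
  rewrite /contacts !big_cons big_nil /= !(contact_hess0, contact_hess1, contact_hess2).
  rewrite !selfE /stress /=; ring.
have -> : self (w 0) + self (w 1) + self (w 2) + self (w 3) + self (w 4) + self (w 5) =
  
    (-2175 / 8) * (e * e) + (-345 / 4) * (e * f) + (345 / 4) * (e * g) +
    95 * (e * y) + (-1115 / 8) * (f * f) + (-505 / 8) * (f * g) +
    ((-1405 + 465 * s5) / 8) * (f * y) + (-1115 / 8) * (g * g) + ((1405
    + 465 * s5) / 8) * (g * y) + -325 * (y * y).
  rewrite /self u0 v0 y0 u1 v1 y1 u2 v2 y2 u3 v3 y3 u4 v4 y4 u5 v5 y5.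
  by field: h5.
have -> : cross0 s5 (w 0) (w 1) + cross0 s5 (w 1) (w 2) + cross0 s5 (w 2) (w 0)
  + cross0 s5 (w 4) (w 3) + cross0 s5 (w 5) (w 4) + cross0 s5 (w 3) (w 5) =
    (-295 / 8) * (e * e) + (-35 / 3) * (e * f) + (35 / 3) * (e * g) +
    (155 / 12) * (e * y) + (25 / 4) * (f * f) + (365 / 24) * (f * g) +
    ((95 - 35 * s5) / 24) * (f * y) + (25 / 4) * (g * g) + ((-95 - 35 *
    s5) / 24) * (g * y) + (-455 / 24) * (y * y).
  rewrite /cross0 u0 v0 y0 u1 v1 y1 u2 v2 y2 u3 v3 y3 u4 v4 y4 u5 v5 y5.
  by field: h5.
have -> : cross1 s5 (w 0) (w 3) + cross1 s5 (w 1) (w 4) + cross1 s5 (w 2) (w 5) =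
    ((25 + 365 * s5) / 96) * (e * f) + ((-25 - 365 * s5) / 96) * (e * g)
    + ((1085 + 1345 * s5) / 96) * (e * y) + ((-5 - 45 * s5) / 96) * (f *
    f) + ((-35 - 185 * s5) / 48) * (f * g) + ((1105 + 325 * s5) / 96) *
    (f * y) + ((-5 - 45 * s5) / 96) * (g * g) + ((-355 + 145 * s5) / 32)
    * (g * y) + ((-15 - 205 * s5) / 48) * (y * y).
  rewrite /cross1 u0 v0 y0 u1 v1 y1 u2 v2 y2 u3 v3 y3 u4 v4 y4 u5 v5 y5.
  by field: h5.
have -> : cross1 (- s5) (w 0) (w 5) + cross1 (- s5) (w 1) (w 3) +
    cross1 (- s5) (w 2) (w 4) =
    ((25 - 365 * s5) / 96) * (e * f) + ((-25 + 365 * s5) / 96) * (e * g)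
    + ((1085 - 1345 * s5) / 96) * (e * y) + ((-5 + 45 * s5) / 96) * (f *
    f) + ((-35 + 185 * s5) / 48) * (f * g) + ((355 + 145 * s5) / 32) *
    (f * y) + ((-5 + 45 * s5) / 96) * (g * g) + ((-1105 + 325 * s5) /
    96) * (g * y) + ((-15 + 205 * s5) / 48) * (y * y).
  rewrite /cross1 opprK u0 v0 y0 u1 v1 y1 u2 v2 y2 u3 v3 y3 u4 v4 y4 u5 v5 y5.
  by field: h5.
by field: h5.
Qed.

Lemma hess_flex_le (y f g e : R) :
  \sum_(c <- contacts) stress c.1 * contact_hess (contact_gram c.1)
    (rescale (flex y f g e c.2.1)) (rescale (flex y f g e c.2.2)) <=
  - 10 * (y ^+ 2 + f ^+ 2 + g ^+ 2 + e ^+ 2).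
Proof.
have h5 := @s5_sqr R.
rewrite hess_flex.
(* The form separates in p = f + g and m = g - f. The combination 95 P1 + 5 P2 yields 100 p^2 - 105
   s5 p y, [P3] completes the square in m, and [P4] handles the mixed term left in y and e. *)
have P1 : 0 <= (f + g) ^+ 2 - s5 * (f * y) - s5 * (g * y) + 5 / 4 * y ^+ 2.
  by rewrite (_ : _ + _ = (f + g - s5 / 2 * y) ^+ 2) ?sqr_ge0//; field: h5.
have P2 : 0 <= (f + g) ^+ 2 - 2 * (s5 * (f * y)) - 2 * (s5 * (g * y)) + 5 * y ^+ 2.
  by rewrite (_ : _ + _ = (f + g - s5 * y) ^+ 2) ?sqr_ge0//; field: h5.
have P3 := sqr_ge0 (g - f - 38 / 53 * y - 15 / 53 * e).
have P4 := sqr_ge0 (y - 16 / 15 * e).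
have := sqr_ge0 y; have := sqr_ge0 e.
move=> e2 y2; lra.
Qed.

End Equilibrium.

(** * Comparison of norms *)

Section NormComparison.
Context {R : realType} {n : nat}.
Implicit Types (G : 'M[R]_n) (v : 'rV[R]_n).

Lemma quadratic_formE G v :
  (v *m G *m v^T) 0 0 = \sum_j \sum_i G i j * v 0 i * v 0 j.
Proof.
rewrite mxE; apply: eq_bigr => j _; rewrite !mxE mulr_suml.
by apply: eq_bigr => i _; rewrite (mulrC (v 0 i)).
Qed.

Lemma quadratic_form_continuous G :
  continuous (fun v : 'rV[R]_n => (v *m G *m v^T) 0 0).
Proof.
under eq_fun do rewrite quadratic_formE.
apply: continuous_big => [|j _]; first exact: add_continuous.
apply: continuous_big => [|i _]; first exact: add_continuous.
move=> v; exact: (cvgM (cvgM (cvg_cst _) (@coord_continuous _ _ _ 0 i v))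
  (@coord_continuous _ _ _ 0 j v)).
Qed.

Lemma quadratic_form_le G :
  exists2 M, 0 < M & forall v, (v *m G *m v^T) 0 0 <= M * `|v| ^+ 2.
Proof.
have [M hM] : dominated 2 (fun v => (v *m G *m v^T) 0 0).
  under [X in dominated _ X]eq_fun do rewrite quadratic_formE.
  apply: dominated_sum => j; apply: dominated_sum => i.
  apply: (@dominatedM _ _ 1 1); last exact: dominated_entry.
  by apply: dominatedZ; exact: dominated_entry.
exists (`|M| + 1); first by rewrite ltr_wpDl.
move=> v; apply: le_trans (ler_norm _) (le_trans (hM v) _).
by rewrite ler_wpM2r ?sqr_ge0// (le_trans (ler_norm _))// lerDl.
Qed.

(** The constant is the minimum of the form on the unit sphere of the sup norm, which is compact. *)
Lemma quadratic_form_ge G : (forall v, v != 0 -> 0 < (v *m G *m v^T) 0 0) ->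
  exists2 m, 0 < m & forall v, m * `|v| ^+ 2 <= (v *m G *m v^T) 0 0.
Proof.
move=> G_gt0; pose S := [set v : 'rV[R]_n | `|v| = 1].
have scale v : v != 0 -> exists2 u, S u & v = `|v| *: u.
  move=> v0; have nv0 : `|v| != 0 by rewrite normr_eq0.
  exists (`|v|^-1 *: v); last by rewrite scalerA divff// scale1r.
  by rewrite /S/= normrZ normfV normr_id mulVf.
(* The sphere is empty when [n] is 0; any positive constant then works. *)
have [S0|/set0P SN0] := eqVneq S set0.
  exists 1 => // v; have [->|/scale[u]] := eqVneq v 0; last by rewrite S0.
  by rewrite normr0 expr0n/= mulr0 quadratic_formE big1// => j _;
    rewrite big1// => i _; rewrite !mxE mulr0.
have Scompact : compact S.
  apply: bounded_closed_compact.
    by exists 1; split=> // x x1 v /= ->; exact: ltW.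
  rewrite (_ : S = (fun v : 'rV[R]_n => `|v|) @^-1` [set 1]); last by [].
  by apply: closed_comp => [v _|]; [exact: norm_continuous|exact: closed_eq].
have [u /set_mem Su umin] := EVT_min_rV SN0 Scompact
  (continuous_subspaceT (@quadratic_form_continuous G)).
have u0 : u != 0 by rewrite -normr_eq0 Su oner_neq0.
exists ((u *m G *m u^T) 0 0); first exact: G_gt0.
move=> v; have [->|/scale[w Sw vE]] := eqVneq v 0.
  by rewrite normr0 expr0n/= mulr0 quadratic_formE sumr_ge0// => j _;
    rewrite sumr_ge0// => i _; rewrite !mxE mulr0.
rewrite [in leRHS]vE linearZ/= -!scalemxAl -scalemxAr scalerA [leRHS]mxE -expr2.
by rewrite [leRHS]mulrC ler_wpM2r ?sqr_ge0//; apply: umin; exact/mem_set.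
Qed.

End NormComparison.

(** * Tangent directions at C_m *)

Section Configurations.
Context {R : realType}.
Implicit Types (a : 'M[R]_(6, 3)) (i j : 'I_6).
Local Notation D0 := (Num.sqrt (12 / 11 : R)).

Definition dir a i := side i *: direction (a i 0) (a i 1) (a i 2).
Definition conor a i := side i *: conormal (a i 0) (a i 1) (a i 2).
Definition dir_dot a i j : R := dotv (dir a i) (dir a j).
Definition dir_pairing a i j : R :=
  dotv (conor a i) (dir a j) + dotv (dir a i) (conor a j).
(* By line_dist_lines, the excess has the sign of the squared distance of the
   two lines minus 12 / 11. *)
Definition excess a i j : R :=
  11 * dir_pairing a i j ^+ 2 - 12 * (1 - dir_dot a i j ^+ 2).

Lemma dir_dotC a i j : dir_dot a i j = dir_dot a j i.
Proof. exact: dotvC. Qed.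

Lemma excessC a i j : excess a i j = excess a j i.
Proof.
rewrite /excess dir_dotC; congr (11 * _ ^+ 2 - _).
by rewrite /dir_pairing [RHS]addrC; congr (_ + _); exact: dotvC.
Qed.

Lemma lineN (x u : 'rV[R]_3) : line x (- u) = line x u.
Proof.
apply/seteqP; split=> _ [s _ <-]; exists (- s) => //.
  by rewrite scalerN scaleNr.
by rewrite scaleNr scalerN opprK.
Qed.

Lemma line_dist_lines a i j : dir_dot a i j ^+ 2 < 1 ->
  line_dist (lines a i) (lines a j) =
  Num.sqrt (dir_pairing a i j ^+ 2 / (1 - dir_dot a i j ^+ 2)).
Proof.
move=> S1.
have linesE k : lines a k = line (sphere_point (a k 0) (a k 1)) (dir a k).
  rewrite /lines /dir /side; case: ifP => _; rewrite ?scale1r// scaleN1r lineN.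
  by [].
have dir1 k : dotv (dir a k) (dir a k) = 1.
  have [[_ u1 _] _] := frame_orthonormal (a k 0) (a k 1) (a k 2).
  by rewrite /dir dotvZl dotvZr u1 mulr1 -expr2 side_sqr.
have crossZ x u s : crossv x (s *: u) = s *: crossv x u.
  by rewrite /crossv scale_vec3 !mxE; congr vec3; ring.
rewrite !linesE line_distE// pluecker_pairing.
by rewrite /dir !crossZ !crossv_direction.
Qed.

Lemma min_dist_lines_le a i j k : i != j -> dir_dot a i j ^+ 2 < 1 ->
  0 <= k -> excess a i j <= - k ->
  min_dist (lines a) - D0 <= - (k / (22 * D0)).
Proof.
wlog ij : i j / (i < j)%N.
  move=> H; rewrite neq_ltn => /orP[ij|ji].
    by apply: H => //; rewrite neq_ltn ij.
  by rewrite dir_dotC excessC; apply: H => //; rewrite neq_ltn ji.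
move=> _ S1 k0 ek; apply: le_trans (sqrt_le_sub S1 k0 ek).
by rewrite lerD2r -line_dist_lines// min_dist_le.
Qed.

Lemma min_dist_lines_ge a k g0 : 0 < g0 -> 0 <= k ->
  (forall i j, (i < j)%N -> g0 <= 1 - dir_dot a i j ^+ 2 /\ - k <= excess a i j) ->
  - (k / (11 * g0 * D0)) <= min_dist (lines a) - D0.
Proof.
move=> g00 k0 H; rewrite lerBrDl; apply: le_min_dist => i j ij.
have [gS ke] := H i j ij.
rewrite line_dist_lines; last by lra.
by rewrite -lerBrDl; exact: sub_le_sqrt.
Qed.

Definition chart_angles (q : 'rV[R]_15) : 'M[R]_(6, 3) :=
  \matrix_(i, k) if i == 0 then C6_angles phi_m delta_m kappa_m 0 k
                 else q 0 (inord (3 * i.-1 + k)).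

Definition chart_coord (i : 'I_6) (k : 'I_3) : 'I_15 := inord (3 * i.-1 + k).

Lemma chart_coord_val i k : i != 0 -> chart_coord i k = (3 * i.-1 + k)%N :> nat.
Proof.
move=> i0; rewrite inordK//.
have i_gt0 : (0 < i)%N by rewrite lt0n.
apply: (@leq_trans (3 * i.-1 + 3)%N); first by rewrite ltn_add2l.
by rewrite -mulnSr prednK // (leq_mul2l 3 i 5) -ltnS ltn_ord.
Qed.

Definition line_of (j : 'I_15) : 'I_6 := inord (j %/ 3).+1.
Definition angle_of (j : 'I_15) : 'I_3 := inord (j %% 3).

Lemma line_of_val (j : 'I_15) : line_of j = (j %/ 3).+1 :> nat.
Proof. by rewrite inordK// ltnS ltn_divLR. Qed.

Lemma angle_of_val (j : 'I_15) : angle_of j = (j %% 3)%N :> nat.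
Proof. by rewrite inordK// ltn_mod. Qed.

Lemma line_of_neq0 (j : 'I_15) : line_of j != 0.
Proof. by rewrite -val_eqE /= line_of_val. Qed.

Lemma chart_coordK (j : 'I_15) : chart_coord (line_of j) (angle_of j) = j.
Proof.
apply: val_inj; rewrite /= chart_coord_val ?line_of_neq0//.
by rewrite line_of_val angle_of_val /= mulnC -divn_eq.
Qed.

Lemma line_ofK i k : i != 0 -> line_of (chart_coord i k) = i.
Proof.
move=> i0; apply: val_inj; rewrite /= line_of_val chart_coord_val//.
by rewrite mulnC divnMDl// divn_small// addn0 prednK// lt0n.
Qed.

Lemma angle_ofK i k : i != 0 -> angle_of (chart_coord i k) = k.
Proof.
move=> i0; apply: val_inj; rewrite /= angle_of_val chart_coord_val//.
by rewrite mulnC modnMDl modn_small.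
Qed.

Lemma chart_angles_C_m : chart_angles (chart_C_m R) = base_angles.
Proof.
apply/matrixP => i k; rewrite mxE; case: (eqVneq i 0) => [->//|i0].
by rewrite /chart_C_m mxE -/(chart_coord i k) -/(line_of _) -/(angle_of _)
  line_ofK// angle_ofK.
Qed.

Definition angle_velocity (l : 'rV[R]_15) i k : R :=
  if i == 0 then 0 else l 0 (chart_coord i k).

Definition velocity (l : 'rV[R]_15) i : R * R * R :=
  let b := @base_angles R i in
  let v := angle_velocity l i in
  (side i * (v 0 * cos (b 2) + v 1 * (cos (b 0) * sin (b 2))),
   side i * (v 0 * sin (b 2) - v 1 * (cos (b 0) * cos (b 2))),
   v 1 * sin (b 0) - v 2).

(** Inverse of [velocity]: up to the sign [side i], (a, b) arises from (v 0, v 1 cos (b 0)) by a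
    reflection matrix, which is its own inverse. *)
Definition of_velocity i (w : R * R * R) (k : 'I_3) : R :=
  let b := @base_angles R i in
  let v1 := side i * (w.1.1 * sin (b 2) - w.1.2 * cos (b 2)) / cos (b 0) in
  nth 0 [:: side i * (w.1.1 * cos (b 2) + w.1.2 * sin (b 2)); v1;
            v1 * sin (b 0) - w.2] k.

Lemma cos_base_neq0 i : cos (@base_angles R i 0) != 0.
Proof.
have [[-> _ _ _] _] := @base_anglesE R i.
by rewrite !mulf_neq0// lt0r_neq0// ?s2_gt0 ?s11_gt0.
Qed.

Lemma of_velocityK (l : 'rV[R]_15) i k :
  of_velocity i (velocity l i) k = angle_velocity l i k.
Proof.
have c0 := cos_base_neq0 i; have s1 := @side_sqr R i.
have d1 := sin2cos2 (@base_angles R i 2).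
have v1E : side i * ((velocity l i).1.1 * sin (base_angles i 2) -
    (velocity l i).1.2 * cos (base_angles i 2)) / cos (base_angles i 0) =
    angle_velocity l i 1.
  apply: (mulIf c0); rewrite divfK// /velocity /=; ring: s1 d1.
rewrite /of_velocity v1E.
have : k \in [:: 0; 1; 2] by case: k => [[|[|[|]]] //].
rewrite !inE => /or3P[]/eqP-> //=.
- by rewrite /velocity /=; ring: s1 d1.
- by rewrite /velocity /=; ring.
Qed.

Definition of_velocities (w : 'I_6 -> R * R * R) : 'rV[R]_15 :=
  \row_j of_velocity (line_of j) (w (line_of j)) (angle_of j).

Lemma velocity0 l : velocity l 0 = (0, 0, 0).
Proof. by rewrite /velocity /angle_velocity eqxx !mul0r addr0 !subr0 !mulr0. Qed.

Lemma velocityK w : w 0 = (0, 0, 0) -> velocity (of_velocities w) =1 w.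
Proof.
move=> w0 i; have [->|i0] := eqVneq i 0; first by rewrite w0 velocity0.
have c0 := cos_base_neq0 i; have s1 := @side_sqr R i.
have d1 := sin2cos2 (@base_angles R i 2).
have avE k : angle_velocity (of_velocities w) i k = of_velocity i (w i) k.
  by rewrite /angle_velocity (negPf i0) mxE line_ofK// angle_ofK.
rewrite /velocity !avE /of_velocity /=.
case: (w i) => [[a b] c] /=; congr (_, _, _).
- by field: s1 d1.
- by field: s1 d1.
- ring.
Qed.

Lemma velocity_inj l l' : velocity l =1 velocity l' -> l = l'.
Proof.
move=> ll'; apply/rowP => j.
have : angle_velocity l (line_of j) (angle_of j) =
    angle_velocity l' (line_of j) (angle_of j).
  by rewrite -!of_velocityK ll'.
by rewrite /angle_velocity (negPf (line_of_neq0 j)) chart_coordK.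
Qed.

End Configurations.

(** * The common kernel of the twelve derivatives *)

Section QuadraticSpace.
Context {R : realType}.
Local Notation s5 := (@s5 R).

Definition flex_row (y : 'rV[R]_4) : 'rV[R]_15 :=
  of_velocities (fun i => rescale (flex (y 0 0) (y 0 1) (y 0 2) (y 0 3) i)).

Definition comb (k : R) (v w : R * R * R) : R * R * R :=
  (k * v.1.1 + w.1.1, k * v.1.2 + w.1.2, k * v.2 + w.2).

Lemma of_velocity_comb i k v w m :
  of_velocity i (comb k v w) m = k * of_velocity i v m + of_velocity i w m.
Proof.
have c0 := @cos_base_neq0 R i.
have : m \in [:: 0; 1; 2] by case: m => [[|[|[|]]] //].
by rewrite !inE => /or3P[]/eqP->; rewrite /of_velocity /comb /=; field.
Qed.

Lemma flex_comb (k y f g e y' f' g' e' : R) i :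
  flex (k * y + y') (k * f + f') (k * g + g') (k * e + e') i =
  comb k (flex y f g e i) (flex y' f' g' e' i).
Proof.
by case: i => [[|[|[|[|[|[|]]]]]] ?] //; rewrite /flex /comb /=;
  congr (_, _, _); field.
Qed.

Lemma rescale_comb (k : R) v w : rescale (comb k v w) = comb k (rescale v) (rescale w).
Proof. by rewrite /rescale /comb /=; congr (_, _, _); ring. Qed.

Lemma flex_row_linear : linear flex_row.
Proof.
move=> k y y'; apply/rowP => j.
by rewrite !mxE flex_comb rescale_comb of_velocity_comb.
Qed.

HB.instance Definition _ := GRing.isLinear.Build R 'rV[R]_4 'rV[R]_15 _ flex_row
  flex_row_linear.

Definition quadratic_space : {vspace 'rV[R]_15} := limg (linfun flex_row).

Lemma velocity_flex_row y i : velocity (flex_row y) i =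
  rescale (flex (y 0 0) (y 0 1) (y 0 2) (y 0 3) i).
Proof. by rewrite velocityK// /rescale /flex /= !mulr0. Qed.

Lemma rescaleK : cancel (@rescale R) (@unscale R).
Proof.
have [n2 n3 n5 n11] : [/\ @s2 R != 0, @s3 R != 0, s5 != 0 & @s11 R != 0].
  by split; rewrite lt0r_neq0// ?s2_gt0 ?s3_gt0 ?s5_gt0 ?s11_gt0.
case=> [[a b] c]; rewrite /rescale /unscale /=.
by congr (_, _, _); rewrite mulrC mulKf ?mulf_neq0.
Qed.

Lemma flex_row_inj : injective flex_row.
Proof.
have h5 := @s5_sqr R.
have params y f g e :
    [/\ fY (@flex R y f g e 1) = y,
        (3 - s5) * s5 / 20 * fU (- s5) (flex y f g e 1) = f,
        (3 + s5) * s5 / 20 * fU s5 (flex y f g e 2) = g &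
        fY (flex y f g e 4) = e].
  by rewrite /fY /fU /flex /=; split; field: h5.
move=> y y' yy'.
have E i : flex (y 0 0) (y 0 1) (y 0 2) (y 0 3) i =
    flex (y' 0 0) (y' 0 1) (y' 0 2) (y' 0 3) i.
  by rewrite -[LHS]rescaleK -[RHS]rescaleK -!velocity_flex_row yy'.
have [y0 y1 y2 y3] := params (y 0 0) (y 0 1) (y 0 2) (y 0 3).
have [y'0 y'1 y'2 y'3] := params (y' 0 0) (y' 0 1) (y' 0 2) (y' 0 3).
have y0E : y 0 0 = y' 0 0 by rewrite -[LHS]y0 E.
have y1E : y 0 1 = y' 0 1 by rewrite -[LHS]y1 E.
have y2E : y 0 2 = y' 0 2 by rewrite -[LHS]y2 E.
have y3E : y 0 3 = y' 0 3 by rewrite -[LHS]y3 E.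
apply/rowP => m.
have : m \in [:: 0; 1; 2; 3] by case: m => [[|[|[|[|]]]] //].
by rewrite !inE => /or4P[]/eqP->; rewrite (y0E, y1E, y2E, y3E).
Qed.

Lemma dim_quadratic_space : \dim quadratic_space = 4%N.
Proof.
rewrite limg_dim_eq ?dimvf; first by rewrite /dim /= mul1n.
apply/eqP; rewrite -subv0 (_ : lker _ = 0%VS) ?capv0 ?subvv//.
apply/eqP/lker0P => y y'; rewrite !lfunE /=; exact: flex_row_inj.
Qed.

Lemma mem_quadratic_spaceP l :
  reflect (exists y, l = flex_row y) (l \in quadratic_space).
Proof.
apply: (iffP memv_imgP) => [[y _ ->]|[y ->]]; exists y; rewrite ?memvf ?lfunE//.
Qed.

Definition slope (l : 'rV[R]_15) (c : nat * ('I_6 * 'I_6)) : R :=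
  contact_deriv (contact_gram c.1) (velocity l c.2.1) (velocity l c.2.2).

Lemma slope_sum l : \sum_(c <- contacts) stress c.1 * slope l c = 0 :> R.
Proof. exact: equilibrium. Qed.

Lemma mem_quadratic_space_slope l :
  l \in quadratic_space <-> {in contacts, forall c, slope l c = 0}.
Proof.
split=> [/mem_quadratic_spaceP[y ->] c cc|H].
  by rewrite /slope !velocity_flex_row contact_deriv_flex.
apply/mem_quadratic_spaceP.
pose w i := unscale (velocity l i).
have w0 : w 0 = (0, 0, 0) by rewrite /w velocity0 /unscale /= !mul0r.
have wc : {in contacts, forall c, contact_deriv (contact_gram c.1)
    (rescale (w c.2.1)) (rescale (w c.2.2)) = 0}.
  by move=> c cc; rewrite !unscaleK; exact: H.
have wE := flexP w0 wc.
exists (\row_m nth 0 [:: fY (w 1); (3 - s5) * s5 / 20 * fU (- s5) (w 1);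
  (3 + s5) * s5 / 20 * fU s5 (w 2); fY (w 4)] m).
apply: velocity_inj => i.
by rewrite velocity_flex_row !mxE /= -wE unscaleK.
Qed.

(** Converts the negative definite bound in the four parameters into one in [|l|], with a constant
    valid for the whole subspace. *)
Lemma flex_row_norm_le :
  exists2 C : R, 0 < C & forall y : 'rV[R]_4, `|flex_row y| ^+ 2 <=
    C * (y 0 0 ^+ 2 + y 0 1 ^+ 2 + y 0 2 ^+ 2 + y 0 3 ^+ 2).
Proof.
pose C := \sum_(r < 4) `|flex_row (delta_mx 0 r)|.
have C0 : 0 <= C by apply: sumr_ge0.
exists (C ^+ 2 + 1); first by rewrite ltr_wpDl ?sqr_ge0.
move=> y; set Q := (X in _ * X).
have Q0 : 0 <= Q by rewrite !addr_ge0 ?sqr_ge0.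
have yQ r : `|y 0 r| <= Num.sqrt Q.
  rewrite -sqrtr_sqr ler_wsqrtr//.
  have : r \in [:: 0; 1; 2; 3] by case: r => [[|[|[|[|]]]] //].
  have := (sqr_ge0 (y 0 0), sqr_ge0 (y 0 1), sqr_ge0 (y 0 2), sqr_ge0 (y 0 3)).
  by rewrite /Q !inE => -[[[]]] ? ? ? ? /or4P[]/eqP->; lra.
have : `|flex_row y| <= C * Num.sqrt Q.
  rewrite [in leLHS](row_sum_delta y) linear_sum /=.
  rewrite (le_trans (ler_norm_sum _ _ _))// /C mulr_suml ler_sum// => r _.
  by rewrite linearZ /= normrZ mulrC ler_wpM2l.
move=> /(lerXn2r 2); rewrite !nnegrE => /(_ (normr_ge0 _) (mulr_ge0 C0 (sqrtr_ge0 _))).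
rewrite exprMn sqr_sqrtr// => /le_trans; apply.
by rewrite ler_wpM2r// lerDl.
Qed.

End QuadraticSpace.

(** * Expansion of the minimal distance *)

Section Averages.
Context {R : realType} {I : eqType}.
Implicit Types (s : seq I) (m f : I -> R).

(** Meant for the second order coefficients, of which only the weighted sum is under control. *)
Lemma exists_le_average s m f K : {in s, forall c, 0 < m c} -> s != [::] ->
  \sum_(c <- s) m c * f c <= K * \sum_(c <- s) m c ->
  exists2 c, c \in s & f c <= K.
Proof.
move=> m0 sN0 H; apply: contrapT => /forall2NP noc.
have fK c : c \in s -> K < f c.
  by move=> cs; have [//|/negP] := noc c; rewrite -ltNge.
have : K * \sum_(c <- s) m c < \sum_(c <- s) m c * f c.
  rewrite mulr_sumr; case: s sN0 m0 fK {H noc} => // a s _ m0 fK.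
  rewrite !big_cons ltr_leD//.
    by rewrite mulrC ltr_pM2l ?m0 ?fK ?mem_head.
  rewrite [leLHS]big_seq [leRHS]big_seq ler_sum// => c cs.
  have cas : c \in a :: s by rewrite inE cs orbT.
  by rewrite mulrC ler_wpM2l ?ltW ?m0 ?fK.
by rewrite ltNge H.
Qed.

(** Meant for the slopes: the stress sums them to 0, so in a direction outside their common kernel
    they cannot all be nonnegative. *)
Lemma exists_lt0_of_sum0 s m f : {in s, forall c, 0 < m c} ->
  \sum_(c <- s) m c * f c = 0 -> (exists2 c, c \in s & f c != 0) ->
  exists2 c, c \in s & f c < 0.
Proof.
move=> m0 sum0 [d ds fd]; apply: contrapT => /forall2NP noc.
have f0 c : c \in s -> 0 <= f c.
  by move=> cs; have [//|/negP] := noc c; rewrite -leNgt.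
have : \sum_(c <- s) m c * f c <= 0 by rewrite sum0.
rewrite leNgt => /negP; apply.
rewrite big_seq lt0r sumr_ge0 ?andbT; last first.
  by move=> c cs; rewrite mulr_ge0 ?f0// ltW ?m0.
rewrite psumr_neq0; last by move=> c cs; rewrite mulr_ge0 ?f0// ltW ?m0.
apply/hasP; exists d => //; rewrite ds /= mulr_gt0 ?m0//.
by rewrite lt0r fd f0.
Qed.

End Averages.

(** * From bounds on P to bounds on the minimal distance *)

Section MinDistJets.
Context {R : realType}.
Variables (g : 'rV[R]_15 -> 'M[R]_15) (expm : 'rV[R]_15 -> 'rV[R]_15).
Hypothesis expP : exponential_map (chart_domain R) g (chart_C_m R) expm.
Implicit Types (l : 'rV[R]_15) (i j : 'I_6) (k : 'I_3).
Local Notation D0 := (Num.sqrt (12 / 11 : R)).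
Let angles l t := chart_angles (expm (t *: l)).

Lemma chart_angle_jets i k : angle_jets (fun l t => angles l t i k)
  (@base_angles R i k) (fun l => angle_velocity l i k).
Proof.
have [->|i0] := eqVneq i 0.
  have E l t : angles l t 0 k = @base_angles R 0 k by rewrite mxE.
  split; exists (fun=> 0).
    apply: jets_ext (jets_cst (cos (@base_angles R 0 k))) _ _ _ _ => //.
      by move=> l t; rewrite E.
    by move=> l; rewrite /angle_velocity /= mulr0.
  apply: jets_ext (jets_cst (sin (@base_angles R 0 k))) _ _ _ _ => //.
    by move=> l t; rewrite E.
  by move=> l; rewrite /angle_velocity /= mulr0.
have E q : chart_angles q i k = q 0 (chart_coord i k).
  by rewrite mxE (negPf i0).
have Nsin (x : R) : is_derive x (1 : R) (fun y => - sin y) (- cos x).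
  exact: is_deriveN.
have bE : @base_angles R i k = chart_C_m R 0 (chart_coord i k).
  by rewrite -chart_angles_C_m E.
split.
- have [c _ cj] := exponential_jets (chart_coord i k) expP (@is_derive_cos R) Nsin.
  exists c; apply: jets_ext cj _ _ _ _ => [l t||l|//]; rewrite ?bE//.
    by rewrite /angles E.
  by rewrite /angle_velocity (negPf i0).
- have [c _ cj] := exponential_jets (chart_coord i k) expP (@is_derive_sin R)
    (@is_derive_cos R).
  exists c; apply: jets_ext cj _ _ _ _ => [l t||l|//]; rewrite ?bE//.
    by rewrite /angles E.
  by rewrite /angle_velocity (negPf i0).
Qed.

Lemma line_frame_jets : exists w2 : 'I_6 -> 'rV[R]_15 -> R * R * R, forall i,
  frame_jets (frame i) (fun l t => dir (angles l t) i)
    (fun l t => conor (angles l t) i) (fun l => velocity l i) (w2 i).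
Proof.
have H i : exists w, frame_jets (frame i) (fun l t => dir (angles l t) i)
    (fun l t => conor (angles l t) i) (fun l => velocity l i) w.
  have [e [f [h [Uj Zj]]]] := line_jets (@side_sqr R i) (chart_angle_jets i 0)
    (chart_angle_jets i 1) (chart_angle_jets i 2).
  exists (fun l => (- e l, - f l, h l)); split=> k.
    by apply: jets_ext (Uj k) _ _ _ _ => // l; rewrite /= opprK.
  by apply: jets_ext (Zj k) _ _ _ _ => // l; rewrite /= opprK.
by have [w2 w2P] := choice H; exists w2.
Qed.

Lemma dir_dot_base i j :
  dir_dot (@base_angles R) i j = gram (frame i) (frame j) 1 1.
Proof. by rewrite mxE. Qed.

Lemma excess_base i j :
  excess (@base_angles R) i j = contact_value (gram (frame i) (frame j)).
Proof. by rewrite /contact_value !mxE. Qed.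

Lemma gram_pair_le i j : (i < j)%N -> @gram R (frame i) (frame j) 1 1 ^+ 2 <= 3 / 4.
Proof.
move: i j; apply: contacts_cover => [i j|c cc|c cf].
- by rewrite -!dir_dot_base dir_dotC.
- rewrite gram_contact//; apply: contact_gram_le.
  by move: cc; rewrite !inE; do 12?[case/orP]; move=> /eqP->.
- by have [] := @far_pair_gram R _ cf.
Qed.

Lemma contact_kind_lt3 c : c \in contacts -> (c.1 < 3)%N.
Proof. by rewrite !inE; do 12?[case/orP]; move=> /eqP->. Qed.

Lemma contact_pair_neq c : c \in contacts -> c.2.1 != c.2.2.
Proof. by rewrite !inE; do 12?[case/orP]; move=> /eqP->. Qed.

Lemma min_dist_base : min_dist (lines (@base_angles R)) = D0.
Proof.
apply/eqP; rewrite -subr_eq0 eq_le; apply/andP; split.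
  have c0 : (0%N, (0, 1)) \in contacts by rewrite inE eqxx.
  have := @min_dist_lines_le R base_angles 0 1 0 isT.
  rewrite mul0r oppr0; apply=> //; last first.
    by rewrite excess_base (gram_contact c0) contact_gram_value.
  by rewrite dir_dot_base; have := @gram_pair_le 0 1 isT; lra.
have := @min_dist_lines_ge R base_angles 0 (1 / 8).
rewrite mul0r oppr0; apply=> //.
move=> i j ij; split.
  by rewrite dir_dot_base; have := gram_pair_le ij; lra.
move: i j ij; apply: contacts_cover => [i j|c cc|c cf].
- by rewrite excessC.
- by rewrite excess_base gram_contact// contact_gram_value// contact_kind_lt3.
- by rewrite excess_base; have [/ltW] := @far_pair_gram R _ cf.
Qed.

(** At C_m every 1 - S^2 is at least 1 / 4, and half of this survives nearby. *)
Lemma near_dir_dot l : \forall t \near 0^'+, forall i j, (i < j)%N ->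
  1 / 8 <= 1 - dir_dot (angles l t) i j ^+ 2.
Proof.
have [w2 w2P] := line_frame_jets.
have H i j : (i < j)%N -> \forall t \near 0^'+,
    1 / 8 <= 1 - dir_dot (angles l t) i j ^+ 2.
  move=> ij.
  have [Ui _] := w2P i; have [Uj _] := w2P j.
  have [/(_ l) Sj _ _] := dotv_jets Ui Uj.
  have Gj := jetD (jet_cst 1) (jetN (jetM Sj Sj)).
  have gle := gram_pair_le ij; rewrite mxE in gle.
  have G0 : 0 < 1 + - (dotv (frame i 1) (frame j 1) * dotv (frame i 1) (frame j 1)) :> R.
    by rewrite -expr2; lra.
  have := jet_gt0 Gj G0; apply: filterS => t.
  by rewrite -!expr2 -/(dir_dot _ i j); lra.
have /filter_forall H' : forall p : 'I_6 * 'I_6, \forall t \near 0^'+,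
    (p.1 < p.2)%N -> 1 / 8 <= 1 - dir_dot (angles l t) p.1 p.2 ^+ 2.
  move=> [i j] /=; have [ij|_] := boolP (i < j)%N.
    by have := H i j ij; apply: filterS.
  by apply: nearW => t.
by apply: filterS H' => t h i j; exact: (h (i, j)).
Qed.

Lemma near_far_excess l c : c \in far_pairs ->
  \forall t \near 0^'+, 0 <= excess (angles l t) c.1 c.2.
Proof.
have [w2 w2P] := line_frame_jets => cf.
have [/(_ l) Pj _ _] := contact_jets (w2P c.1) (w2P c.2).
have [v0 _] := @far_pair_gram R _ cf.
have := jet_gt0 Pj v0; apply: filterS => t.
by apply: le_trans; rewrite divr_ge0// ltW.
Qed.

(** [h] is t^2 on the kernel and t outside it, so that one estimate serves both cases. Far pairs
    impose nothing, their excess being nonnegative for small [t]. *)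
Lemma near_min_dist_ge l (h : R -> R) K : 0 <= K ->
  (\forall t \near 0^'+, 0 <= h t) ->
  {in contacts, forall c, \forall t \near 0^'+,
    - (K * h t) <= excess (angles l t) c.2.1 c.2.2} ->
  \forall t \near 0^'+, - (K / (11 * (1 / 8) * D0)) * h t <=
    min_dist (chart (expm (t *: l))) - min_dist (C_m R).
Proof.
move=> K0 h0 Hc.
have H i j : (i < j)%N -> \forall t \near 0^'+,
    - (K * h t) <= excess (angles l t) i j.
  move: i j; apply: contacts_cover => [i j|//|c cf].
    by apply: filterS => t; rewrite excessC.
  near=> t; apply: (@le_trans _ _ 0).
    by rewrite oppr_le0 mulr_ge0//; near: t.
  by near: t; exact: near_far_excess.
have /filter_forall H' : forall p : 'I_6 * 'I_6, \forall t \near 0^'+,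
    (p.1 < p.2)%N -> - (K * h t) <= excess (angles l t) p.1 p.2.
  move=> [i j] /=; have [ij|_] := boolP (i < j)%N.
    by have := H i j ij; apply: filterS.
  by apply: nearW => t.
near=> t.
rewrite mulNr mulrAC -[C_m R]/(lines base_angles) min_dist_base.
apply: (@min_dist_lines_ge R (angles l t)); first by lra.
  by rewrite mulr_ge0//; near: t.
have G : forall i j, (i < j)%N -> 1 / 8 <= 1 - dir_dot (angles l t) i j ^+ 2.
  by near: t; exact: near_dir_dot.
have Ht : forall p : 'I_6 * 'I_6, (p.1 < p.2)%N ->
    - (K * h t) <= excess (angles l t) p.1 p.2 by near: t.
by move=> i j ij; split; [exact: G|exact: (Ht (i, j))].
Unshelve. all: by end_near. Qed.

Lemma near_min_dist_le l (h : R -> R) K c : 0 <= K -> c \in contacts ->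
  (\forall t \near 0^'+, 0 <= h t) ->
  (\forall t \near 0^'+, excess (angles l t) c.2.1 c.2.2 <= - (K * h t)) ->
  \forall t \near 0^'+, min_dist (chart (expm (t *: l))) - min_dist (C_m R) <=
    - (K / (22 * D0)) * h t.
Proof.
move=> K0 cc h0 Hc.
have cn := contact_pair_neq cc.
near=> t.
rewrite mulNr mulrAC -[C_m R]/(lines base_angles) min_dist_base.
apply: (@min_dist_lines_le R (angles l t) c.2.1 c.2.2) => //.
- have G : forall i j, (i < j)%N -> 1 / 8 <= 1 - dir_dot (angles l t) i j ^+ 2.
    by near: t; exact: near_dir_dot.
  move: cn; rewrite neq_ltn => /orP[/G|/G]; first by lra.
  by rewrite dir_dotC; lra.
- by rewrite mulr_ge0//; near: t.
- by near: t.
Unshelve. all: by end_near. Qed.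

End MinDistJets.

Lemma dominated_uniform (R : realType) (V : normedModType R) (I : eqType) (s : seq I)
    (b : I -> V -> R) d : {in s, forall c, dominated d (b c)} ->
  exists2 C, 0 <= C & {in s, forall c l, `|b c l| <= C * `|l| ^+ d}.
Proof.
elim: s => [|a s IHs] H; first by exists 0.
have [|C C0 hC] := IHs _; first by move=> c cs; apply: H; rewrite inE cs orbT.
have [A hA] : dominated d (b a) by apply: H; rewrite mem_head.
exists (`|A| + C); first by rewrite addr_ge0.
move=> c; rewrite inE => /orP[/eqP->|cs] l.
  apply: le_trans (hA l) _; rewrite ler_wpM2r ?exprn_ge0//.
  by rewrite (le_trans (ler_norm _))// lerDl.
by apply: le_trans (hC _ cs l) _; rewrite ler_wpM2r ?exprn_ge0// lerDr.
Qed.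

(* The second derivatives of the individual distances depend on the metric; their
   stress-weighted sum does not, because the first order terms cancel. *)
Lemma excess_jets (R : realType) (g : 'rV[R]_15 -> 'M[R]_15)
    (expm : 'rV[R]_15 -> 'rV[R]_15) :
  exponential_map (chart_domain R) g (chart_C_m R) expm ->
  exists q : nat * ('I_6 * 'I_6) -> 'rV[R]_15 -> R,
    {in contacts, forall c, jets
      (fun l t => excess (chart_angles (expm (t *: l))) c.2.1 c.2.2) 0
      (fun l => slope l c) (q c)} /\
    forall l, \sum_(c <- contacts) stress c.1 * q c l =
      \sum_(c <- contacts) stress c.1 * contact_hess (contact_gram c.1)
        (velocity l c.2.1) (velocity l c.2.2).
Proof.
move=> expP; have [w2 w2P] := line_frame_jets expP.
exists (fun c l =>
  contact_hess (contact_gram c.1) (velocity l c.2.1) (velocity l c.2.2) +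
  contact_deriv (contact_gram c.1) (w2 c.2.1 l) (w2 c.2.2 l)); split=> [c cc|l].
  have := contact_jets (w2P c.2.1) (w2P c.2.2).
  by rewrite (gram_contact cc) contact_gram_value ?contact_kind_lt3.
under eq_bigr do rewrite mulrDr.
by rewrite big_split /= (equilibrium (fun i => w2 i l)) addr0.
Qed.

Unset Implicit Arguments.

Theorem mainTheorem2 (R : realType)
    (g : 'rV[R]_15 -> 'M[R]_15) (expm : 'rV[R]_15 -> 'rV[R]_15)
    (g_metric : riemannian_metric (chart_domain R) g)
    (expm_exp : exponential_map (chart_domain R) g (chart_C_m R) expm) :
  exists (L_quadr : {vspace 'rV[R]_15}) (c_d c_u : R),
    [/\ \dim L_quadr = 4%N,
        0 < c_d <= c_u,
        forall l : 'rV[R]_15, l \in L_quadr ->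
          \forall t \near 0^'+,
            - c_u * riemannian_norm g (chart_C_m R) l ^+ 2 * t ^+ 2
              <= min_dist (chart (expm (t *: l))) - min_dist (C_m R)
              <= - c_d * riemannian_norm g (chart_C_m R) l ^+ 2 * t ^+ 2
      & forall l : 'rV[R]_15, l \notin L_quadr ->
          exists c_d' c_u' : R,
            0 < c_d' <= c_u' /\
            \forall t \near 0^'+,
              - c_u' * t <= min_dist (chart (expm (t *: l))) - min_dist (C_m R)
                         <= - c_d' * t].
Proof.
pose D0 : R := Num.sqrt (12 / 11).
have D00 : 0 < D0 by rewrite sqrtr_gt0 divr_gt0.
have exp0 : expm 0 = chart_C_m R.
  by have [] := expm_exp 0; rewrite scaler0.
(* The constant geodesic of the zero vector lies in the chart domain, hence so does the base
   point. *)
have p_dom : chart_domain R (chart_C_m R).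
  have [_ _ /nbhs_singleton[]] := expm_exp 0.
  by rewrite scaler0 exp0.
have [_ _ /(_ _ p_dom) g_gt0] := g_metric.
have [m m0 mP] := quadratic_form_ge g_gt0.
have [M M0 MP] := quadratic_form_le (g (chart_C_m R)).
have normE l : riemannian_norm g (chart_C_m R) l ^+ 2 =
    (l *m g (chart_C_m R) *m l^T) 0 0.
  by rewrite sqr_sqrtr// (le_trans _ (mP l))// mulr_ge0 ?sqr_ge0// ltW.
have [q [qj q_sum]] := excess_jets expm_exp.
have [C C0 qC] : exists2 C, 0 <= C &
    {in contacts, forall c l, `|q c l| <= C * `|l| ^+ 2}.
  by apply: dominated_uniform => c /qj[].
have [Cy Cy0 CyP] := @flex_row_norm_le R.
have stress0 : {in contacts, forall c, 0 < @stress R c.1}.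
  by move=> c /contact_kind_lt3; exact: stress_gt0.
(* 10 comes from [hess_flex_le], 42 is the total stress, and [Cy] passes from the parameters to the
   norm of [l]. *)
pose k := 10 / (42 * Cy).
have k0 : 0 < k by rewrite divr_gt0// mulr_gt0.
have t2_ge0 : \forall t \near (0 : R)^'+, 0 <= t ^+ 2.
  by apply: nearW => t; exact: sqr_ge0.
have t_ge0 : \forall t \near (0 : R)^'+, 0 <= t.
  by near=> t; apply: ltW; near: t; exact: nbhs_right_gt.
(* Half of [k] leaves room for the remainder, 22 D0 comes from the square root, and [M] passes to
   the Riemannian norm. *)
pose cd := k / 2 / (22 * D0) / M.
have cd0 : 0 < cd by rewrite /cd !divr_gt0// mulr_gt0.
pose cu := (C + 1) / (11 * (1 / 8) * D0) / m.
have cu0 : 0 <= cu.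
  by rewrite /cu !divr_ge0 ?addr_ge0 ?mulr_ge0// ltW.
exists quadratic_space, cd, (cu + cd); split.
- exact: dim_quadratic_space.
- by rewrite cd0 lerDr.
(* At [l] = 0 there is no strict gap to absorb a remainder, but the configuration does not move. *)
- move=> l lL; have [->|l0] := eqVneq l 0.
    apply: nearW => t.
    rewrite scaler0 exp0 chart_chart_C_m subrr normE !mul0mx mxE !mulr0 !mul0r.
    by rewrite lexx.
  have slope0 := (mem_quadratic_space_slope l).1 lL.
  have nl0 : 0 < `|l| ^+ 2 by rewrite exprn_gt0// normr_gt0.
  have [c cc qc] : exists2 c, c \in contacts & q c l <= - (k * `|l| ^+ 2).
    apply: (exists_le_average stress0) => //.
    rewrite q_sum stress_sum.
    have [y yE] := mem_quadratic_spaceP l lL.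
    rewrite {}yE; have Cy' := CyP y.
    under eq_bigr do rewrite !velocity_flex_row.
    apply: le_trans (hess_flex_le _ _ _ _) _.
    rewrite /k.
    have -> : - (10 / (42 * Cy) * `|flex_row y| ^+ 2) * 42 =
        - (10 * (`|flex_row y| ^+ 2 / Cy)).
      by field; exact: lt0r_neq0.
    rewrite mulNr lerN2 ler_pM2l// ler_pdivrMr// mulrC.
    exact: Cy'.
  have up := @near_min_dist_le R g expm expm_exp l (fun t => t ^+ 2)
    (k / 2 * `|l| ^+ 2) c _ cc t2_ge0 _.
  have lo := @near_min_dist_ge R g expm expm_exp l (fun t => t ^+ 2)
    ((C + 1) * `|l| ^+ 2) _ t2_ge0 _.
  near=> t; apply/andP; split.
  + apply: (@le_trans _ _ (- ((C + 1) * `|l| ^+ 2 / (11 * (1 / 8) * D0)) * t ^+ 2)).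
      rewrite !mulNr lerN2 ler_wpM2r ?sqr_ge0// normE.
      apply: (@le_trans _ _ (cu * (l *m g (chart_C_m R) *m l^T) 0 0)); last first.
        rewrite ler_wpM2r ?lerDl ?(ltW cd0)//.
        by rewrite (le_trans _ (mP l))// mulr_ge0 ?sqr_ge0// ltW.
      rewrite (_ : _ / _ = cu * (m * `|l| ^+ 2)) ?ler_wpM2l//.
      by rewrite /cu; field; rewrite !lt0r_neq0.
    near: t; apply: lo; first by rewrite mulr_ge0 ?addr_ge0// ltW.
    move=> c' cc'; have [/(_ l)/jetN jc' _ _] := qj _ cc'.
    rewrite oppr0 slope0// oppr0 in jc'.
    have : - q c' l < (C + 1) * `|l| ^+ 2.
      apply: le_lt_trans (ler_norm _) _; rewrite normrN.
      by apply: le_lt_trans (qC _ cc' l) _; rewrite ltr_pM2r// ltrDl.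
    by move=> /(jet_le jc') /(_ (lexx _)); apply: filterS => t; rewrite lerNl.
  + apply: (@le_trans _ _ (- (k / 2 * `|l| ^+ 2 / (22 * D0)) * t ^+ 2)); last first.
      rewrite !mulNr lerN2 ler_wpM2r ?sqr_ge0// normE.
      rewrite (_ : k / 2 * _ / _ = cd * (M * `|l| ^+ 2)) ?ler_wpM2l ?(ltW cd0)//.
      by rewrite /cd; field; rewrite !lt0r_neq0.
    near: t; apply: up; first by rewrite mulr_ge0 ?sqr_ge0// divr_ge0// ltW.
    have [/(_ l) jc _ _] := qj _ cc; rewrite slope0// in jc.
    have : q c l < - (k / 2 * `|l| ^+ 2).
      apply: le_lt_trans qc _; rewrite ltrN2 ltr_pM2r//.
      by rewrite ltr_pdivrMr// ltr_pMr// ltr1n.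
    by move=> /(jet_le jc) /(_ (lexx _)); apply: filterS => t; rewrite mulNr.
- move=> l lL.
  have [c cc sc] : exists2 c, c \in contacts & slope l c < 0.
    apply: (exists_lt0_of_sum0 stress0); first exact: slope_sum.
    apply: contrapT => H; move/negP: lL; apply.
    apply/mem_quadratic_space_slope => c cc; apply/eqP/negPn/negP => sc.
    by apply: H; exists c.
  pose b := - slope l c / 2.
  have b0 : 0 < b by rewrite divr_gt0// oppr_gt0.
  (* One bound for all the slopes, made strict by the added 1. *)
  pose K := \sum_(c <- contacts) `|slope l c| + 1.
  have K0 : 0 < K by rewrite ltr_wpDl// sumr_ge0.
  have up := @near_min_dist_le R g expm expm_exp l id b c (ltW b0) cc t_ge0 _.
  have lo := @near_min_dist_ge R g expm expm_exp l id K (ltW K0) t_ge0 _.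
  pose cd' := b / (22 * D0); pose cu' := K / (11 * (1 / 8) * D0).
  have cd'0 : 0 < cd' by rewrite divr_gt0// mulr_gt0.
  have cu'0 : 0 < cu' by rewrite divr_gt0// !mulr_gt0// divr_gt0.
  exists cd', (cu' + cd'); split; first by rewrite cd'0 lerDr ltW.
  near=> t.
  have t0 : 0 <= t by near: t.
  apply/andP; split.
  + apply: (@le_trans _ _ (- cu' * t)).
      by rewrite !mulNr lerN2 ler_wpM2r// lerDl ltW.
    near: t; apply: lo => c' cc'; have [/(_ l)/jetN jc' _ _] := qj _ cc'.
    rewrite oppr0 in jc'.
    have : - slope l c' < K.
      apply: le_lt_trans (ler_norm _) _; rewrite normrN /K ltr_pwDr//.
      by rewrite (big_rem c')//= lerDl sumr_ge0.
    by move=> /(jet_lt jc'); apply: filterS => t; rewrite lerNl.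
  + near: t; apply: up.
    have [/(_ l) jc _ _] := qj _ cc.
    have : slope l c < - b.
      by rewrite /b; lra.
    by move=> /(jet_lt jc); apply: filterS => t; rewrite mulNr.
Unshelve. all: by end_near. Qed.
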